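(* Let $\Psi:[0,\infty)\to\mathbb{R}$ be measurable, let $V:\mathbb{R}^d\to\mathbb{R}$, and consider $H=H_0+V$ on $L^2(\mathbb{R}^d)$ with $H_0=\Psi(p^2/2)$, $p=-i\nabla$. Suppose that: (H.1) $\Psi\in C^1(0,\infty)$, $\Psi\ge 0$, $\Psi'\ge 0$, and $\Psi(+0)=\Psi(0)=0$; (H.3) there exist constants $c_2,d_2\ge 0$ such that $u\Psi'(u)\le c_2\Psi(u)+d_2$ for all $u\ge 0$; (H.4) there exists a constant $\mu>0$ such that $2u\Psi'(u)\ge\mu\Psi(u)$ for all $u\ge 0$; (H.6) $V\in C^1(\mathbb{R}^d)$ and there are constants $c,\gamma>0$ such that $|V(x)|\le c\langle x\rangle^{-\gamma}$ and $|\nabla V(x)|\le c\langle x\rangle^{-1-\gamma}$ for all $x\in\mathbb{R}^d$. Suppose moreover that, with the constant $\mu$ of (H.4), $$-\mu V(x)-x\cdot\nabla V(x)\ge 0\quad\text{for all }x\in\mathbb{R}^d.$$ Then $H$ has no positive eigenvalue.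
   Context: $\langle x\rangle=\sqrt{1+|x|^2}$. $H_0=\Psi(p^2/2)$ is the Fourier multiplier with symbol $\Psi(|\xi|^2/2)$; since $V$ is bounded by (H.6), $H$ is self-adjoint on $\mathrm{Dom}(H)=\mathrm{Dom}(H_0)$. At $u=0$, where $\Psi'$ need not be defined, $u\Psi'(u)$ is read as $0$. *)

(* Defs.v *)
From HB Require Import structures.
From mathcomp Require Import all_boot all_order all_algebra.
From mathcomp Require Import all_classical all_reals all_analysis.
From mathcomp Require Import complex.

Set Implicit Arguments.
Unset Strict Implicit.
Unset Printing Implicit Defensive.
Import Order.TTheory GRing.Theory Num.Theory.
Import numFieldNormedType.Exports.
Local Open Scope classical_set_scope.
Local Open Scope complex_scope.
Local Open Scope ring_scope.

Definition rV_display : measure_display.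
Proof. exact: default_measure_display. Qed.

(* The sigma-algebra on R^n generated by the coordinates, that is, the Borel
   sigma-algebra. *)
Section measurable_rV.
Context {R : realType} (n : nat).

Let coords : 'I_n -> 'rV[R]_n -> measurableTypeR R := fun i x => x ord0 i.

Let rV_measurable0 : g_sigma_preimage coords set0.
Proof. exact: sigma_algebra0. Qed.

Let rV_measurableC A :
  g_sigma_preimage coords A -> g_sigma_preimage coords (~` A).
Proof. exact: sigma_algebraC. Qed.

Let rV_measurable_bigcup (F : (set 'rV[R]_n)^nat) :
  (forall i, g_sigma_preimage coords (F i)) ->
  g_sigma_preimage coords (\bigcup_i (F i)).
Proof. exact: sigma_algebra_bigcup. Qed.

HB.instance Definition _ := @isMeasurable.Build rV_display
  'rV[R]_n (g_sigma_preimage coords)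
  rV_measurable0 rV_measurableC rV_measurable_bigcup.

End measurable_rV.

Section lebesgue_rV.
Context {R : realType}.

Lemma measurable_coord n (i : 'I_n) :
  measurable_fun [set: 'rV[R]_n]
    ((fun x => x ord0 i) : 'rV[R]_n -> measurableTypeR R).
Proof.
move=> _ Y mY; rewrite setTI; apply: sub_sigma_algebra => /=.
rewrite -bigcup_seq/=; exists i => /=; first by rewrite mem_index_enum.
by exists Y => //; rewrite setTI.
Qed.

Lemma measurable_fun_rVP d (T : measurableType d) n (f : T -> 'rV[R]_n) :
  (forall i, measurable_fun [set: T]
     ((fun x => f x ord0 i) : T -> measurableTypeR R)) ->
  measurable_fun [set: T] f.
Proof.
move=> mf; suff H : preimage_set_system [set: T] f measurable `<=` measurable.
  by move=> _ A mA; apply: H; exists A.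
rewrite [X in preimage_set_system _ _ X](_ : _ = g_sigma_preimage
  ((fun i x => x ord0 i) : 'I_n -> 'rV[R]_n -> measurableTypeR R))//.
rewrite -g_sigma_preimage_comp.
apply: smallest_sub; first exact: sigma_algebra_measurable.
rewrite -bigcup_seq/=; apply: bigcup_sub => i _.
by move=> A [B mB <-]; exact: (mf i).
Qed.

Definition cons_rV n (p : measurableTypeR R * 'rV[R]_n) : 'rV[R]_n.+1 :=
  row_mx (const_mx p.1 : 'rV[R]_1) p.2.

Lemma cons_rV0 n (p : measurableTypeR R * 'rV[R]_n) :
  cons_rV p ord0 ord0 = p.1.
Proof.
have := row_mxEl (const_mx p.1 : 'rV[R]_1) p.2 ord0 ord0.
rewrite [RHS]mxE => <-; rewrite /cons_rV; congr (row_mx _ _ _ _).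
exact: val_inj.
Qed.

Lemma cons_rVS n (p : measurableTypeR R * 'rV[R]_n) (i : 'I_n) :
  cons_rV p ord0 (lift ord0 i) = p.2 ord0 i.
Proof.
have <- := row_mxEr (const_mx p.1 : 'rV[R]_1) p.2 ord0 i.
rewrite /cons_rV; congr (row_mx _ _ _ _).
exact: val_inj.
Qed.

Lemma measurable_cons_rV n : measurable_fun setT (@cons_rV n).
Proof.
apply: measurable_fun_rVP => i; case: (unliftP ord0 i) => [j|] ->.
  under eq_fun do rewrite cons_rVS.
  exact: (measurableT_comp (measurable_coord j) measurable_snd).
under eq_fun do rewrite cons_rV0.
exact: measurable_fst.
Qed.

(* Lebesgue measure on R^n: R^0 is a point of mass 1, and R^(n+1) carries the
   image of the product measure under (t, x) |-> (t, x_0, ..., x_(n-1)). *)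
Fixpoint lebesgue_rV n : set 'rV[R]_n -> \bar R :=
  match n with
  | 0 => \d_(0 : 'rV[R]_0)
  | n.+1 => pushforward (lebesgue_measure \x @lebesgue_rV n)%E (@cons_rV n)
  end.

Definition box_rV n (A : 'I_n -> set R) : set 'rV[R]_n :=
  [set x | forall i, A i (x ord0 i)].

Lemma measurable_box_rV n (A : 'I_n -> set (measurableTypeR R)) :
  (forall i, measurable (A i)) -> measurable (box_rV A).
Proof.
move=> mA; rewrite (_ : box_rV A = \big[setI/setT]_(i < n)
    ((fun x : 'rV[R]_n => x ord0 i : measurableTypeR R) @^-1` A i)).
  apply: bigsetI_measurable => i _; rewrite -[X in measurable X]setTI.
  exact: measurable_coord.
rewrite -bigcap_seq; apply/seteqP; split => x /= Ax i.
  by move=> _; exact: Ax.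
by apply: Ax; rewrite /= mem_index_enum.
Qed.

Lemma preimage_cons_rV_box n (A : 'I_n.+1 -> set R) :
  @cons_rV n @^-1` box_rV A =
  A ord0 `*` box_rV (fun i : 'I_n => A (lift ord0 i)).
Proof.
apply/seteqP; split => [[t x] /= Ax|[t x] /= [At Ax] i].
  split => [|i /=]; first by have := Ax ord0; rewrite cons_rV0.
  by have := Ax (lift ord0 i); rewrite cons_rVS.
by case: (unliftP ord0 i) => [j|] ->; rewrite ?cons_rVS ?cons_rV0.
Qed.

Lemma sigma_finite_measure_exists d (T : measurableType d)
    (mu : {measure set T -> \bar R}) : sigma_finite setT mu ->
  exists nu : {sigma_finite_measure set T -> \bar R},
    (nu : set T -> \bar R) = mu.
Proof.
move=> smu.
pose H1 := isSFinite.Build d T R mu (sfinite_measure_sigma_finite smu).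
pose H2 := isSigmaFinite.Build d T R mu smu.
pose nu : {sigma_finite_measure set T -> \bar R} :=
  HB.pack (Measure.sort mu) H1 H2.
by exists nu.
Qed.

Lemma pushforward_measure_exists d d' (T : measurableType d)
    (T' : measurableType d') (mu : {measure set T -> \bar R}) (f : T -> T') :
  measurable_fun setT f ->
  exists nu : {measure set T' -> \bar R},
    (nu : set T' -> \bar R) = pushforward mu f.
Proof.
move=> mf; pose nu : {measure set T' -> \bar R} :=
  measure_function_pushforward__canonical__measure_function_Measure mu mf.
by exists nu.
Qed.

Let lebesgue_rV_spec n :
  (exists nu : {sigma_finite_measure set 'rV[R]_n -> \bar R},
    (nu : set 'rV[R]_n -> \bar R) = @lebesgue_rV n) /\
  forall A : 'I_n -> set (measurableTypeR R), (forall i, measurable (A i)) ->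
    lebesgue_rV (box_rV A) = (\prod_(i < n) lebesgue_measure (A i))%E.
Proof.
elim: n => [|n [[nu nuE] IH]] /=.
  split; first by exists \d_(0 : 'rV[R]_0).
  move=> A _; rewrite big_ord0 diracE mem_set//=.
  by move=> [].
rewrite -nuE in IH *.
have boxE (A : 'I_n.+1 -> set (measurableTypeR R)) :
    (forall i, measurable (A i)) ->
    pushforward (lebesgue_measure \x nu)%E (@cons_rV n) (box_rV A) =
    (\prod_(i < n.+1) lebesgue_measure (A i))%E.
  move=> mA; rewrite /pushforward preimage_cons_rV_box.
  rewrite product_measure1E//; last exact: measurable_box_rV.
  by rewrite big_ord_recl IH.
split => //.
have [mu muE] := @pushforward_measure_exists _ _ _ _
  (lebesgue_measure \x nu)%E _ (@measurable_cons_rV n).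
rewrite -muE; apply: sigma_finite_measure_exists.
exists (fun k => box_rV (fun=> `[- k%:R, k%:R]%classic)).
  apply/seteqP; split => // x _.
  pose M := \sum_(i < n.+1) `|x ord0 i|.
  have M0 : 0 <= M by exact: sumr_ge0.
  exists (Num.truncn M).+1 => //= i; change (x ord0 i \in `[- (Num.truncn M).+1%:R, (Num.truncn M).+1%:R]%R).
  rewrite in_itv/= -ler_norml.
  apply: (@le_trans _ _ M); last exact: (ltW (truncnS_gt _)).
  by rewrite /M (bigD1 i)//= lerDl sumr_ge0.
move=> k; split; first by apply: measurable_box_rV => i; exact: measurable_itv.
rewrite muE boxE; last by move=> i; exact: measurable_itv.
suff /fin_numP[_] : (\prod_(i < n.+1) lebesgue_measure
    (`[- k%:R, k%:R]%classic%R : set (measurableTypeR R)))%E \is a fin_num.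
  by rewrite -ltey.
apply: prode_fin_num => i _; rewrite lebesgue_measure_itv/=.
by case: ifP.
Qed.

Section lebesgue_rV_instance.
Variable n : nat.

Let lebesgue_rV_axioms :
  [/\ @lebesgue_rV n set0 = 0%E, forall A, (0 <= @lebesgue_rV n A)%E,
      semi_sigma_additive (@lebesgue_rV n) & sigma_finite setT (@lebesgue_rV n)].
Proof.
have [[nu <-] _] := lebesgue_rV_spec n.
by split => //; [exact: measure_semi_sigma_additive|exact: sigma_finiteT].
Qed.

Let lebesgue_rV0 : @lebesgue_rV n set0 = 0%E.
Proof. by case: lebesgue_rV_axioms. Qed.

Let lebesgue_rV_ge0 A : (0 <= @lebesgue_rV n A)%E.
Proof. by case: lebesgue_rV_axioms. Qed.

Let lebesgue_rV_sigma_additive : semi_sigma_additive (@lebesgue_rV n).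
Proof. by case: lebesgue_rV_axioms. Qed.

Let lebesgue_rV_sigma_finite : sigma_finite setT (@lebesgue_rV n).
Proof. by case: lebesgue_rV_axioms. Qed.

HB.instance Definition _ := isMeasure.Build _ _ _ (@lebesgue_rV n)
  lebesgue_rV0 lebesgue_rV_ge0 lebesgue_rV_sigma_additive.

HB.instance Definition _ := Measure_isSigmaFinite.Build _ _ _ (@lebesgue_rV n)
  lebesgue_rV_sigma_finite.

End lebesgue_rV_instance.

Lemma lebesgue_rV_box n (A : 'I_n -> set (measurableTypeR R)) :
  (forall i, measurable (A i)) ->
  lebesgue_rV (box_rV A) = (\prod_(i < n) lebesgue_measure (A i))%E.
Proof. by have [_] := lebesgue_rV_spec n; apply. Qed.

End lebesgue_rV.

Section euclidean.
Context {R : realType} {d : nat}.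
Implicit Types x y : 'rV[R]_d.

Definition dot x y : R := \sum_(i < d) x ord0 i * y ord0 i.

(* The library norm on 'rV[R]_d is the sup norm. *)
Definition enorm x : R := Num.sqrt (dot x x).

Definition japanese x : R := Num.sqrt (1 + enorm x ^+ 2).

Definition grad (V : 'rV[R]_d -> R) x : 'rV[R]_d :=
  \row_(i < d) 'D_(delta_mx ord0 i) V x.

Definition C1_rV (V : 'rV[R]_d -> R) : Prop :=
  (forall x, differentiable V x) /\ continuous (grad V).

End euclidean.

Section complex_functions.
Context {R : realType} {d : nat}.
Local Notation mu := (@lebesgue_rV R d).
Implicit Types f g : 'rV[R]_d -> R[i].

Definition cmodulus (z : R[i]) : R := ComplexField.Normc.normc z.

Definition cmeasurable f : Prop :=
  measurable_fun [set: 'rV[R]_d] (fun x => complex.Re (f x)) /\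
  measurable_fun [set: 'rV[R]_d] (fun x => complex.Im (f x)).

Definition cLp (p : \bar R) f : Prop :=
  cmeasurable f /\ finite_norm mu p (fun x => cmodulus (f x)).

Definition cLnorm (p : \bar R) f : \bar R :=
  Lnorm mu p (fun x => (cmodulus (f x))%:E).

Definition cintegral f : R[i] :=
  (\int[mu]_x complex.Re (f x)) +i* (\int[mu]_x complex.Im (f x)).

Definition expi (t : R) : R[i] := cos t +i* sin t.

Definition fourier_integral f (xi : 'rV[R]_d) : R[i] :=
  (((Num.sqrt (2 * pi)) ^- d)%:C) *
  cintegral (fun x => expi (- dot x xi) * f x).

(* The Fourier transform on L^2(R^d), as a relation between representatives:
   the extension by continuity of [fourier_integral] from the dense subspace
   L^1 /\ L^2. *)
Definition fourier_L2 f g : Prop :=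
  [/\ cLp 2%:E f, cLp 2%:E g &
    exists f_ : nat -> 'rV[R]_d -> R[i],
      [/\ forall k, cLp 1%:E (f_ k) /\ cLp 2%:E (f_ k),
          cLnorm 2%:E (f_ k \- f) @[k --> \oo] --> 0%E &
          cLnorm 2%:E (fourier_integral (f_ k) \- g) @[k --> \oo] --> 0%E]].

(* Operators on L^2(R^d) are given by their graphs; T f g reads: f belongs to
   Dom(T) and T f = g almost everywhere. *)
Definition operator := ('rV[R]_d -> R[i]) -> ('rV[R]_d -> R[i]) -> Prop.

(* By Plancherel's theorem the domain is the set of all f in L^2 such that
   m times the Fourier transform of f is in L^2. *)
Definition fourier_multiplier (m : 'rV[R]_d -> R) : operator := fun f g =>
  exists2 fhat, fourier_L2 f fhat & fourier_L2 g (fun xi => (m xi)%:C * fhat xi).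

Definition free_hamiltonian (Psi : R -> R) : operator :=
  fourier_multiplier (fun xi => Psi (enorm xi ^+ 2 / 2)).

(* H_0 + V with Dom(H_0 + V) = Dom(H_0), for a bounded potential V. *)
Definition hamiltonian (Psi : R -> R) (V : 'rV[R]_d -> R) : operator :=
  fun f g => exists2 g0, free_hamiltonian Psi f g0 &
    {ae mu, forall x, g x = g0 x + (V x)%:C * f x}.

Definition is_eigenvalue (T : operator) (z : R[i]) : Prop :=
  exists f g, [/\ cLp 2%:E f, ~ {ae mu, forall x, f x = 0}, T f g &
    {ae mu, forall x, g x = z * f x}].

End complex_functions.

Definition C1_pos {R : realType} (Psi : R -> R) : Prop :=
  forall u, 0 < u -> derivable Psi u 1 /\ {for u, continuous (derive1 Psi)}.

(* Main.v *)
(* Let H f = lambda f with lambda > 0. Comparing <H f, f_a> with <f, (H f)_a> for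
   the dilation f_a(x) = f(a x), a = e^t, and using Parseval for the kinetic part,
   gives
     <(Psi(u) - Psi(u/a^2)) fh, ha> + <(V(x) - V(a x)) f, f_a> = 0
   with u = |xi|^2/2, fh the transform of f and ha that of f_a. By (H.4) and the
   virial hypothesis, Psi(u) - Psi(u/a^2) >= (1 - e^(-mu t)) Psi(u) and
   V(x) - V(a x) >= (1 - e^(-mu t)) V(x); by (H.3) and (H.6) both differences are
   O(t) in a sense controlled by L^2 norms. Replacing f_a by f in both brackets
   thus yields
     (1 - e^(-mu t)) lambda |f|^2 <= C_f t |f_a - f|,
   and t -> 0 contradicts lambda |f|^2 > 0 by continuity of dilations in L^2.
   Plancherel's theorem is proved for real f in L^1 and L^2 by damping |F f|^2 with
   exp(-|xi_1| - ... - |xi_n|), whose transform is a product of Cauchy kernels, and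
   by letting the damping tend to 1. *)

Require Import Defs.
From mathcomp Require Import all_boot all_order all_algebra.
From mathcomp Require Import all_classical all_reals all_analysis.
From mathcomp Require Import complex measurable_realfun ring lra.
Import Order.TTheory GRing.Theory Num.Theory.
Import numFieldNormedType.Exports.
Local Open Scope classical_set_scope.
Local Open Scope complex_scope.
Local Open Scope ring_scope.

Set Implicit Arguments.
Unset Strict Implicit.
Unset Printing Implicit Defensive.

(** * Square-integrable functions *)

(** The classical virial argument evaluates the commutator of [H] with the generator of dilations on
    the eigenfunction, which may lie outside the domain of that generator: nothing is known of
    [x . grad f]. A finite dilation maps L^2 to itself, so the derivative at [t = 0] is replaced by
    an inequality for small [t > 0], whose error [t |f_a - f|] is [o(t)]. The kinetic and the
    potential part must decay at the same rate [mu]: only then do the two lower bounds add up to the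
    total energy [<H_0 f, f> + <V f, f> = lambda |f|^2], whose sign the eigenvalue dictates. The
    bound [c2 Psi + d2] met on the frequency side is in general not a bounded function, but it
    multiplies [fh], and [Psi(u) fh] is in L^2 because [f] is in the domain of [H_0]. Norms appear
    squared only: products are split by [2 x y <= s x^2 + y^2 / s], with a weight [s] fixed before
    [t]. All symbols and [lambda] are real, so the real part of the inner product suffices, and the
    estimates are made on real and imaginary parts separately. *)

Section real_integrals.
Context {d : measure_display} {T : measurableType d} {R : realType}.
Variable mu : {measure set T -> \bar R}.
Implicit Types f g h : T -> R.

Definition integ f := mu.-integrable [set: T] (EFin \o f).

Definition sqint f := measurable_fun [set: T] f /\ integ (fun x => f x ^+ 2).

Definition ip f g := \int[mu]_x (f x * g x).

Lemma integ_measurable f : integ f -> measurable_fun [set: T] f.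
Proof. by move=> /measurable_int /measurable_EFinP. Qed.

Lemma eq_integ f g : f =1 g -> integ f -> integ g.
Proof. by move=> /funext ->. Qed.

Lemma integD f g : integ f -> integ g -> integ (fun x => f x + g x).
Proof. by move=> mf mg; have := integrableD measurableT mf mg. Qed.

Lemma integB f g : integ f -> integ g -> integ (fun x => f x - g x).
Proof. by move=> mf mg; have := integrableB measurableT mf mg. Qed.

Lemma integZ k f : integ f -> integ (fun x => k * f x).
Proof. by move=> mf; have := integrableZl measurableT k mf. Qed.

Lemma integ_norm f : integ f -> integ (fun x => `|f x|).
Proof. exact: integrable_norm. Qed.

Lemma integ_le f g : measurable_fun [set: T] f -> integ g ->
  (forall x, `|f x| <= g x) -> integ f.
Proof.
move=> mf ig fg; apply: (@le_integrable _ _ _ mu _ measurableT _ (EFin \o g)) => //.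
  exact/measurable_EFinP.
by move=> x _ /=; rewrite lee_fin (le_trans (fg x))// ler_norm.
Qed.

Lemma integ_bounded k f g : measurable_fun [set: T] f -> integ g ->
  (forall x, `|f x| <= k) -> integ (fun x => f x * g x).
Proof.
move=> mf ig fk; apply: (integ_le _ (integZ k (integ_norm ig))).
  by apply: measurable_funM => //; exact: integ_measurable.
by move=> x; rewrite normrM ler_wpM2r.
Qed.

Lemma integ_EFin f : integ f ->
  (\int[mu]_x (f x)%:E = (\int[mu]_x f x)%:E)%E.
Proof. by move=> mf; rewrite /Rintegral fineK//; exact: integrable_fin_num. Qed.

Lemma ge0_integP f : measurable_fun [set: T] f -> (forall x, 0 <= f x) ->
  (\int[mu]_x (f x)%:E < +oo)%E -> integ f.
Proof.
move=> mf f0 fy; apply/integrableP; split; first exact/measurable_EFinP.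
by under eq_integral => x _ do rewrite /= ger0_norm//.
Qed.

Lemma RintD f g : integ f -> integ g ->
  \int[mu]_x (f x + g x) = \int[mu]_x f x + \int[mu]_x g x.
Proof. exact: RintegralD. Qed.

Lemma RintB f g : integ f -> integ g ->
  \int[mu]_x (f x - g x) = \int[mu]_x f x - \int[mu]_x g x.
Proof. exact: RintegralB. Qed.

Lemma RintZ k f : integ f -> \int[mu]_x (k * f x) = k * \int[mu]_x f x.
Proof. exact: RintegralZl. Qed.

Lemma le_Rint f g : integ f -> integ g -> (forall x, f x <= g x) ->
  \int[mu]_x f x <= \int[mu]_x g x.
Proof. by move=> mf mg fg; apply: le_Rintegral. Qed.

(** Replacing [g - f] by its positive part changes it on a null set only, and the integral of a
    positive part is nonnegative. *)
Lemma ae_le_Rint f g : integ f -> integ g -> {ae mu, forall x, f x <= g x} ->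
  \int[mu]_x f x <= \int[mu]_x g x.
Proof.
move=> mf mg fg; rewrite -subr_ge0 -RintB//.
pose h x := Num.max 0 (g x - f x).
have -> : \int[mu]_x (g x - f x) = \int[mu]_x h x.
  congr fine; apply: ae_eq_integral => //.
  - exact: measurable_int (integB mg mf).
  - apply/measurable_EFinP; apply: measurable_maxr => //.
    exact: integ_measurable (integB mg mf).
  - apply: filterS fg => x fgx _ /=; congr EFin; rewrite /h.
    by apply/esym/max_idPr; rewrite subr_ge0.
by apply: Rintegral_ge0 => x _; rewrite /h le_max lexx.
Qed.

Lemma sqintM f g : sqint f -> sqint g -> integ (fun x => f x * g x).
Proof.
move=> [mf if2] [mg ig2]; apply: (integ_le _ (integD if2 ig2)).
  exact: measurable_funM.
move=> x; rewrite ler_norml; have := sqr_ge0 (f x - g x).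
have := sqr_ge0 (f x + g x); have := sqr_ge0 (f x); have := sqr_ge0 (g x).
rewrite !sqrrD sqrrN mulrN; lra.
Qed.

Lemma sqintD f g : sqint f -> sqint g -> sqint (fun x => f x + g x).
Proof.
move=> sf sg; split; first by apply: measurable_funD; [case: sf|case: sg].
have := integD (integD (proj2 sf) (proj2 sg)) (integZ 2 (sqintM sf sg)).
by apply: eq_integ => x /=; ring.
Qed.

Lemma sqintZ k f : sqint f -> sqint (fun x => k * f x).
Proof.
move=> [mf if2]; split; first exact: measurable_funM.
by have := integZ (k ^+ 2) if2; apply: eq_integ => x; ring.
Qed.

Lemma eq_sqint f g : f =1 g -> sqint f -> sqint g.
Proof. by move=> /funext ->. Qed.

Lemma sqintB f g : sqint f -> sqint g -> sqint (fun x => f x - g x).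
Proof.
move=> sf sg; have := sqintD sf (sqintZ (-1) sg).
by apply: eq_sqint => x; ring.
Qed.

Lemma sqint_norm f : sqint f -> sqint (fun x => `|f x|).
Proof.
move=> [mf if2]; split; first exact: measurableT_comp.
by apply: eq_integ if2 => x; rewrite real_normK// num_real.
Qed.

Lemma ipC f g : ip f g = ip g f.
Proof. by apply: eq_Rintegral => x _; rewrite mulrC. Qed.

Lemma ip_ge0 f : 0 <= ip f f.
Proof. by apply: Rintegral_ge0 => x _; rewrite -expr2 sqr_ge0. Qed.

Lemma ipDl f g h : sqint f -> sqint g -> sqint h ->
  ip (fun x => f x + g x) h = ip f h + ip g h.
Proof.
move=> sf sg sh; rewrite /ip -RintD; [|exact: sqintM..].
by apply: eq_Rintegral => x _; rewrite mulrDl.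
Qed.

Lemma ipZl k f h : sqint f -> sqint h -> ip (fun x => k * f x) h = k * ip f h.
Proof.
move=> sf sh; rewrite /ip -RintZ; last exact: sqintM.
by apply: eq_Rintegral => x _; rewrite mulrA.
Qed.

Lemma ipBl f g h : sqint f -> sqint g -> sqint h ->
  ip (fun x => f x - g x) h = ip f h - ip g h.
Proof.
move=> sf sg sh; rewrite /ip -RintB; [|exact: sqintM..].
by apply: eq_Rintegral => x _; rewrite mulrBl.
Qed.

Lemma ipDr f g h : sqint f -> sqint g -> sqint h ->
  ip h (fun x => f x + g x) = ip h f + ip h g.
Proof. by move=> sf sg sh; rewrite ipC ipDl// ![ip _ h]ipC. Qed.

Lemma ipZr k f h : sqint f -> sqint h -> ip h (fun x => k * f x) = k * ip h f.
Proof. by move=> sf sh; rewrite ipC ipZl// ![ip _ h]ipC. Qed.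

Lemma ipBr f g h : sqint f -> sqint g -> sqint h ->
  ip h (fun x => f x - g x) = ip h f - ip h g.
Proof. by move=> sf sg sh; rewrite ipC ipBl// ![ip _ h]ipC. Qed.

Lemma sq_ipD f g : sqint f -> sqint g ->
  ip (fun x => f x + g x) (fun x => f x + g x) = ip f f + 2 * ip f g + ip g g.
Proof.
move=> sf sg; have sfg := sqintD sf sg.
rewrite ipDl// !ipDr// (ipC g f); ring.
Qed.

Lemma sq_ipB f g : sqint f -> sqint g ->
  ip (fun x => f x - g x) (fun x => f x - g x) = ip f f - 2 * ip f g + ip g g.
Proof.
move=> sf sg; have sfg := sqintB sf sg.
rewrite ipBl// !ipBr// (ipC g f); ring.
Qed.

(** Expansion of [|s f - g|^2 >= 0], divided by [s]. *)
Lemma weighted_cauchy_schwarz f g (s : R) : 0 < s -> sqint f -> sqint g ->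
  2 * ip f g <= s * ip f f + s^-1 * ip g g.
Proof.
move=> s0 sf sg; have := ip_ge0 (fun x => s * f x - g x).
rewrite sq_ipB//; last exact: sqintZ.
rewrite !(ipZl, ipZr)//; last exact: sqintZ.
move=> H; rewrite -(@ler_pM2l _ s)// mulrDr [s * (s^-1 * _)]mulrA mulfV ?gt_eqF//.
lra.
Qed.

(** The quadratic polynomial [|s f + g|^2] in [s] is nonnegative, so its discriminant is not
    positive. *)
Lemma cauchy_schwarz_ip f g : sqint f -> sqint g ->
  ip f g ^+ 2 <= ip f f * ip g g.
Proof.
move=> sf sg; set a := ip f f; set b := ip g g; set c := ip f g.
have H (s : R) : 0 <= s ^+ 2 * a + 2 * s * c + b.
  have := ip_ge0 (fun x => s * f x + g x).
  rewrite sq_ipD//; last exact: sqintZ.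
  rewrite !(ipZl, ipZr)//; last exact: sqintZ.
  by congr (_ <= _); rewrite /a /b /c; ring.
have a0 : 0 <= a := ip_ge0 f.
have b0 : 0 <= b := ip_ge0 g.
have [a_eq0|a_neq0] := eqVneq a 0.
  rewrite a_eq0 mul0r; have [->|c0] := eqVneq c 0; first by rewrite expr0n.
  (* With [a = 0] the polynomial is affine; at this [s] it would take the value [-1]. *)
  have := H (- (b + 1) / (2 * c)); rewrite a_eq0 mulr0 add0r.
  have -> : 2 * (- (b + 1) / (2 * c)) * c = - (b + 1) by field.
  by rewrite opprD addrAC addNr add0r leNgt ltrN10.
(* The minimizer of the quadratic polynomial. *)
have := H (- c / a).
have -> : (- c / a) ^+ 2 * a + 2 * (- c / a) * c + b = (a * b - c ^+ 2) / a.
  by field.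
rewrite pmulr_lge0 ?invr_gt0 ?lt_neqAle ?(eq_sym 0) ?a_neq0//.
by rewrite subr_ge0.
Qed.

Lemma dominated_Rint (f_ : nat -> T -> R) f g :
  (forall n, measurable_fun setT (f_ n)) -> measurable_fun setT f ->
  (forall x, f_ n x @[n --> \oo] --> f x) -> integ g ->
  (forall n x, `|f_ n x| <= g x) ->
  integ f /\ (\int[mu]_x f_ n x @[n --> \oo] --> \int[mu]_x f x).
Proof.
move=> mf_ mf f_f ig fg.
have [|||||If _ H] := @dominated_convergence _ _ _ mu setT measurableT
  (fun n => EFin \o f_ n) (EFin \o f) (EFin \o g).
- by move=> n; exact/measurable_EFinP.
- exact/measurable_EFinP.
- by apply: nearW => x _ /=; apply: cvg_EFin; [exact: nearW|exact: f_f].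
- exact: ig.
- by apply: nearW => x n _ /=; rewrite lee_fin.
- split => //.
  have := H; rewrite (integ_EFin If).
  rewrite [X in X @ _ --> _](_ : _ = (fun n => (\int[mu]_x f_ n x)%:E)).
    by move=> /fine_cvgP[].
  apply/funext => n /=; rewrite -integ_EFin//.
  exact: (integ_le (mf_ n) ig (fg n)).
Qed.

Lemma integ_indic (A : set T) : measurable A -> (mu A < +oo)%E ->
  integ (\1_A : T -> R).
Proof.
move=> mA Ay; apply: ge0_integP => //.
by rewrite integral_indic// setIT.
Qed.

Lemma sqr_indic (A : set T) : (fun x => (\1_A x : R) ^+ 2) = \1_A.
Proof.
by apply/funext => x; rewrite indicE; case: (_ \in _); rewrite ?expr1n ?expr0n.
Qed.

Lemma sqint_indic (A : set T) : measurable A -> (mu A < +oo)%E ->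
  sqint (\1_A : T -> R).
Proof.
move=> mA Ay; split; first exact: measurable_indic.
by rewrite sqr_indic; exact: integ_indic.
Qed.

Lemma Rint_indic (A : set T) : measurable A ->
  \int[mu]_x (\1_A x : R) = fine (mu A).
Proof. by move=> mA; rewrite /Rintegral integral_indic// setIT. Qed.

End real_integrals.

(** * Fubini's theorem for real-valued integrals *)

Section real_fubini.
Context {d1 d2 : measure_display} {T1 : measurableType d1}
  {T2 : measurableType d2} {R : realType}.
Variables (m1 : {sigma_finite_measure set T1 -> \bar R})
          (m2 : {sigma_finite_measure set T2 -> \bar R}).
Implicit Type F : T1 * T2 -> R.

Lemma integ_dominated_prod F p q : measurable_fun [set: T1 * T2] F ->
  integ m1 p -> integ m2 q -> (forall x y, `|F (x, y)| <= p x * q y) ->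
  integ (m1 \x m2)%E F.
Proof.
move=> mF ip iq Fpq; apply/integrable12ltyP; first exact/measurable_EFinP.
have np := integ_norm ip; have nq := integ_norm iq.
apply: (@le_lt_trans _ _
  (\int[m1]_x (`|p x| * \int[m2]_y `|q y|)%:E)%E); last first.
  rewrite ltey_eq integ_EFin//.
  by have := integZ (\int[m2]_y `|q y|) np; apply: eq_integ => x; rewrite mulrC.
apply: ge0_le_integral => //.
- by move=> x _; apply: integral_ge0.
- apply: (@measurable_fun_fubini_tonelli_F _ _ _ _ _ m2
    (fun z => `|(F z)%:E|%E)) => //.
  by apply: measurableT_comp => //; exact/measurable_EFinP.
- apply/measurable_EFinP; apply: measurable_funM => //.
  exact: integ_measurable np.
- move=> x _; apply: (@le_trans _ _ (\int[m2]_y (`|p x| * `|q y|)%:E)%E).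
    apply: ge0_le_integral => //.
    + apply: measurableT_comp => //; apply/measurable_EFinP.
      exact: measurableT_comp mF (pair1_measurable x).
    + apply/measurable_EFinP; apply: measurable_funM; first exact: measurable_cst.
      exact: integ_measurable nq.
    + move=> y _; rewrite lee_fin (le_trans (Fpq x y))//.
      by rewrite (le_trans (ler_norm _))// normrM.
  rewrite integ_EFin; last exact: integZ nq.
  by rewrite RintZ.
Qed.

(** The inner integral, as an extended real, may be infinite on a null set. There [fine] gives it
    the value 0, which affects neither integrability nor the outer integral. *)
Lemma integ_fubini1 F : integ (m1 \x m2)%E F ->
  integ m1 (fun x => \int[m2]_y F (x, y)) /\
  \int[m1]_x \int[m2]_y F (x, y) = \int[(m1 \x m2)%E]_z F z.
Proof.
move=> iF; pose G x := (\int[m2]_y (F (x, y))%:E)%E.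
have iG : m1.-integrable setT G := integrable_fubini_F iF.
have mG := measurable_int _ iG.
have eG : {ae m1, forall x, setT x -> G x = (EFin \o fine \o G) x}.
  have := integrable_ae measurableT iG; apply: filterS => x Gx _ /=.
  by rewrite fineK// Gx.
have mfG : measurable_fun setT (EFin \o fine \o G).
  by apply/measurable_EFinP; apply: measurableT_comp.
split.
  apply/integrableP; split => //.
  move/integrableP : iG => [_]; apply: le_lt_trans.
  apply: ge0_le_integral => //; do ?exact: measurableT_comp.
  move=> x _; rewrite /= /Rintegral -/(G x).
  by case: (G x) => [r| |] /=; rewrite ?normr0 ?leey ?lexx.
rewrite {1}/Rintegral; congr fine.
rewrite -(integral12_prod_meas1 iF); apply: ae_eq_integral => //.
by apply: filterS eG => x Gx Tx; apply/esym; exact: Gx.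
Qed.

Lemma integ_fubini2 F : integ (m1 \x m2)%E F ->
  integ m2 (fun y => \int[m1]_x F (x, y)) /\
  \int[m2]_y \int[m1]_x F (x, y) = \int[(m1 \x m2)%E]_z F z.
Proof.
move=> iF; pose G y := (\int[m1]_x (F (x, y))%:E)%E.
have mF : measurable_fun setT (EFin \o F) := measurable_int _ iF.
have mG : measurable_fun setT G := measurable_fubini_G iF.
have iG : m2.-integrable setT G.
  apply/integrableP; split => //.
  apply: le_lt_trans ((integrable21ltyP m1 m2 mF).1 iF).
  apply: ge0_le_integral => //; first exact: measurableT_comp.
  - apply: (@measurable_fun_fubini_tonelli_G _ _ _ _ _ m1
      (fun z => `|(F z)%:E|%E)) => //.
    exact: measurableT_comp.
  - move=> y _; apply: le_abse_integral => //.
    exact: measurableT_comp mF (pair2_measurable y).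
have eG : {ae m2, forall x, setT x -> G x = (EFin \o fine \o G) x}.
  have := integrable_ae measurableT iG; apply: filterS => x Gx _ /=.
  by rewrite fineK// Gx.
have mfG : measurable_fun setT (EFin \o fine \o G).
  by apply/measurable_EFinP; apply: measurableT_comp.
split.
  apply/integrableP; split => //.
  move/integrableP : iG => [_]; apply: le_lt_trans.
  apply: ge0_le_integral => //; do ?exact: measurableT_comp.
  move=> x _; rewrite /= /Rintegral -/(G x).
  by case: (G x) => [r| |] /=; rewrite ?normr0 ?leey ?lexx.
rewrite {1}/Rintegral; congr fine.
rewrite -(integral21_prod_meas1 iF); apply: ae_eq_integral => //.
by apply: filterS eG => x Gx Tx; apply/esym; exact: Gx.
Qed.

Lemma Rint_fubini F : integ (m1 \x m2)%E F ->
  \int[m1]_x \int[m2]_y F (x, y) = \int[m2]_y \int[m1]_x F (x, y).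
Proof. by move=> iF; rewrite (integ_fubini1 iF).2 (integ_fubini2 iF).2. Qed.

End real_fubini.

(** * Affine changes of variables *)

Section affine_change.
Context {R : realType}.
Implicit Types a b : R.

Lemma measurable_affine1 a b :
  measurable_fun setT ((fun x => a * x + b) : measurableTypeR R -> measurableTypeR R).
Proof. by apply: measurable_funD => //; apply: measurable_funM. Qed.

(** Uniqueness of Lebesgue measure: the image measure scaled by [|a|] gives every interval []x, y]]
    its length. *)
Lemma lebesgue_measure_affine a b (A : set (measurableTypeR R)) : a != 0 ->
  measurable A -> lebesgue_measure A =
    (`|a|%:E * lebesgue_measure ((fun x : R => (a * x + b)%R) @^-1` A))%E.
Proof.
move=> a0 mA; have [nu nuE] := pushforward_measure_exists
  (@lebesgue_measure R) (measurable_affine1 a b).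
have {nuE} nuE : forall X : set (measurableTypeR R),
    nu X = lebesgue_measure ((fun x : R => a * x + b) @^-1` X) by move=> X; rewrite nuE.
rewrite -nuE; apply: (@lebesgue_measure_unique _ (mscale `|a|%:nng nu)) => //.
move=> _ [[x y] _ <-] /=; rewrite /mscale/= nuE lebesgue_measure_itv/= lte_fin.
(* The preimage of []x, y]] is half open on the right when [a < 0] and on the left when [a > 0]. *)
move: a0; rewrite neq_lt => /orP[a0|a0].
  have -> : (fun x0 => a * x0 + b) @^-1` `]x, y] = `[(y - b) / a, (x - b) / a[%classic.
    apply/seteqP; split => t /=; rewrite !in_itv/= ler_ndivrMr// ltr_ndivlMr//;
    by rewrite [t * a]mulrC => /andP[? ?]; apply/andP; split; lra.
  rewrite lebesgue_measure_itv/= lte_fin ltr_nM2r ?invr_lt0// ltrD2r.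
  case: ifPn => xy; last by rewrite mule0.
  rewrite -!EFinB -EFinM ltr0_norm//; congr EFin; field; lra.
have -> : (fun x0 => a * x0 + b) @^-1` `]x, y] = `](x - b) / a, (y - b) / a]%classic.
  apply/seteqP; split => t /=; rewrite !in_itv/= ltr_pdivrMr// ler_pdivlMr//;
  by rewrite [t * a]mulrC => /andP[? ?]; apply/andP; split; lra.
rewrite lebesgue_measure_itv/= lte_fin ltr_pM2r ?invr_gt0// ltrD2r.
case: ifPn => xy; last by rewrite mule0.
rewrite -!EFinB -EFinM gtr0_norm//; congr EFin; field; lra.
Qed.

Definition affine_rV n a (z : 'rV[R]_n) (x : 'rV[R]_n) := a *: x + z.

Lemma measurable_affine_rV n a (z : 'rV[R]_n) :
  measurable_fun setT (affine_rV a z).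
Proof.
apply: measurable_fun_rVP => i.
have -> : (fun x : 'rV[R]_n => affine_rV a z x ord0 i) =
    (fun t => a * t + z ord0 i) \o (fun x => x ord0 i).
  by apply/funext => x /=; rewrite !mxE.
exact: measurableT_comp (measurable_affine1 _ _) (measurable_coord i).
Qed.

End affine_change.

Section affine_change_rV.
Context {R : realType} (n : nat).
Local Notation mu := (@lebesgue_rV R n).
Implicit Types (a : R) (z : 'rV[R]_n).

Definition measurable_boxes : set (set 'rV[R]_n) :=
  [set B | exists2 A : 'I_n -> set (measurableTypeR R),
     forall i, measurable (A i) & B = box_rV A].

Lemma box_rVI (A B : 'I_n -> set R) :
  box_rV A `&` box_rV B = box_rV (fun i => A i `&` B i).
Proof.
apply/seteqP; split=> x /=; first by move=> [Ax Bx] i; split; [exact: Ax|exact: Bx].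
by move=> ABx; split=> i; have [] := ABx i.
Qed.

Lemma measurable_rV_boxes : measurable = <<s measurable_boxes >>.
Proof.
apply/seteqP; split.
  apply: smallest_sub; first exact: smallest_sigma_algebra.
  rewrite -bigcup_seq/=; apply: bigcup_sub => i _ _ [Y mY <-].
  apply: sub_sigma_algebra; rewrite setTI.
  exists (fun j => if j == i then Y else setT).
    by move=> j; case: ifP.
  apply/seteqP; split => x /=.
    by move=> Yx j; case: eqP => // ->.
  by move=> /(_ i); rewrite eqxx.
apply: smallest_sub; first exact: sigma_algebra_measurable.
by move=> _ [A mA ->]; exact: measurable_box_rV.
Qed.

Definition cube (k : nat) : set 'rV[R]_n := box_rV (fun=> `[- k%:R, k%:R]%classic).

Lemma bigcup_cube : \bigcup_k cube k = setT.
Proof.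
apply/seteqP; split => // x _.
pose M := \sum_(i < n) `|x ord0 i|.
have M0 : 0 <= M by exact: sumr_ge0.
exists (Num.truncn M).+1 => //= i; rewrite /= in_itv/= -ler_norml.
apply: (@le_trans _ _ M); last exact: (ltW (truncnS_gt _)).
by rewrite /M (bigD1 i)//= lerDl sumr_ge0.
Qed.

Lemma lebesgue_rV_cube k : mu (cube k) = (\prod_(i < n) (k%:R *+ 2)%:E)%E.
Proof.
rewrite /cube lebesgue_rV_box; last by move=> i; exact: measurable_itv.
apply: eq_bigr => i _; rewrite lebesgue_measure_itv/= lte_fin.
case: ifPn => [_|]; first by rewrite -EFinB opprK mulr2n.
by rewrite -leNgt => k0; congr EFin; have := ler0n R k; lra.
Qed.

Lemma lebesgue_rV_cube_lty k : (mu (cube k) < +oo)%E.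
Proof.
rewrite lebesgue_rV_cube.
suff : (\prod_(i < n) (k%:R *+ 2)%:E)%E \is a @fin_num R.
  by rewrite fin_numElt => /andP[].
by apply: prode_fin_num => i _.
Qed.

Lemma measurable_cube k : measurable (cube k).
Proof. by apply: measurable_box_rV => i; exact: measurable_itv. Qed.

(** Both sides are measures in [A], finite on the cubes, so they need only agree on the pi-system of
    boxes. There each coordinate contributes one factor [|a|]. *)
Lemma lebesgue_rV_affine a z (A : set 'rV[R]_n) : a != 0 -> measurable A ->
  (mu A = (`|a| ^+ n)%:E * mu (affine_rV a z @^-1` A))%E.
Proof.
move=> a0 mA; have [nu nuE] := pushforward_measure_exists
  mu (measurable_affine_rV a z).
have {nuE} nuE : forall X, nu X = mu (affine_rV a z @^-1` X).
  by move=> X; rewrite nuE.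
have cn0 : 0 <= `|a| ^+ n by exact: exprn_ge0.
rewrite -nuE; apply: (measure_unique measurable_boxes cube measurable_rV_boxes
  _ _ bigcup_cube mu (mscale (NngNum cn0) nu)) => //.
- move=> _ _ [A1 mA1 ->] [A2 mA2 ->]; rewrite box_rVI.
  by exists (fun i => A1 i `&` A2 i) => // i; exact: measurableI.
- by move=> k; exists (fun=> `[- k%:R, k%:R]%classic) => // i; exact: measurable_itv.
- move=> _ [B mB ->].
  rewrite [RHS](_ : _ = (`|a| ^+ n)%:E * nu (box_rV B))%E// nuE.
  have -> : affine_rV a z @^-1` box_rV B =
      box_rV (fun i => (fun x => a * x + z ord0 i) @^-1` B i).
    by apply/seteqP; split => x /= Bx i; have := Bx i; rewrite !mxE.
  apply: (etrans (lebesgue_rV_box mB)); rewrite lebesgue_rV_box//; last first.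
    by move=> i; rewrite -[X in measurable X]setTI; exact: measurable_affine1.
  rewrite (eq_bigr _ (fun i _ => lebesgue_measure_affine (z ord0 i) a0 (mB i))).
  rewrite big_split/=; congr (_ * _)%E.
  by elim: (n) => [|m IH]; rewrite ?big_ord0// big_ord_recl IH -EFinM exprS.
- by move=> k; exact: lebesgue_rV_cube_lty.
Qed.

Lemma ge0_integral_affine a z (f : 'rV[R]_n -> \bar R) : a != 0 ->
  measurable_fun setT f -> (forall x, 0 <= f x)%E ->
  (\int[mu]_x f x = (`|a| ^+ n)%:E * \int[mu]_x f (affine_rV a z x))%E.
Proof.
move=> a0 mf f0; have maff := measurable_affine_rV a z.
have [nu nuE] := pushforward_measure_exists mu maff.
have cn0 : 0 <= `|a| ^+ n by exact: exprn_ge0.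
have := @ge0_integral_pushforward _ _ _ _ R _ maff mu setT f measurableT mf.
move=> /(_ (fun x _ => f0 x)); rewrite preimage_setT /= => <-.
have -> : (\int[pushforward mu (affine_rV a z)]_y f y = \int[nu]_y f y)%E.
  apply: eq_measure_integral => A mA _.
  by rewrite nuE.
rewrite -(@ge0_integral_mscale _ _ _ nu setT measurableT (NngNum cn0) f)//.
apply: eq_measure_integral => A mA _.
rewrite [LHS](lebesgue_rV_affine z a0)//.
by rewrite [RHS](_ : _ = (`|a| ^+ n)%:E * nu A)%E// nuE.
Qed.

Lemma measurable_comp_affine a z (f : 'rV[R]_n -> R) :
  measurable_fun setT f -> measurable_fun setT (fun x => f (affine_rV a z x)).
Proof. by move=> mf; exact: measurableT_comp mf (measurable_affine_rV a z). Qed.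

Lemma integ_affine a z (f : 'rV[R]_n -> R) : a != 0 ->
  integ mu f -> integ mu (fun x => f (affine_rV a z x)).
Proof.
move=> a0 /integrableP[mf fy]; apply/integrableP; split.
  exact: measurableT_comp mf (measurable_affine_rV a z).
move: fy; rewrite (@ge0_integral_affine a z (fun x => `|(EFin \o f) x|%E))//; last first.
  exact: measurableT_comp.
set I := (\int[mu]_x `|(EFin \o f) (affine_rV a z x)|)%E; rewrite -/I => Iy.
rewrite ltey; apply/eqP => Iy'; move: Iy.
by rewrite -[X in (_ * X)%E]/I Iy' gt0_muley// lte_fin exprn_gt0// normr_gt0.
Qed.

(** The nonnegative case applies to [f + |f|] and to [|f|], whose difference is [f]. *)
Lemma Rint_affine a z (f : 'rV[R]_n -> R) : a != 0 -> integ mu f ->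
  \int[mu]_x f x = `|a| ^+ n * \int[mu]_x f (affine_rV a z x).
Proof.
move=> a0 mf; have nf := integ_norm mf.
have ge0 g : (forall x, 0 <= g x) -> integ mu g ->
    \int[mu]_x g x = `|a| ^+ n * \int[mu]_x g (affine_rV a z x).
  move=> g0 ig; apply: EFin_inj; rewrite EFinM -!integ_EFin//; last first.
    exact: integ_affine.
  rewrite (@ge0_integral_affine a z (EFin \o g))//.
  exact: measurable_int ig.
have H : \int[mu]_x (f x + `|f x|) =
    `|a| ^+ n * \int[mu]_x (f (affine_rV a z x) + `|f (affine_rV a z x)|).
  apply: (ge0 (fun x => f x + `|f x|)) => [x|].
    by have := lerNnormlW (lexx `|f x|); lra.
  exact: integD.
have mfa := integ_affine z a0 mf; have nfa := integ_affine z a0 nf.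
move: H; rewrite RintD// (RintD mfa nfa).
by rewrite (ge0 (fun x => `|f x|))// mulrDr => /addIr.
Qed.

Lemma ae_affine a z (P : 'rV[R]_n -> Prop) : a != 0 ->
  {ae mu, forall x, P x} -> {ae mu, forall x, P (affine_rV a z x)}.
Proof.
move=> a0 [N [mN N0 PN]]; exists (affine_rV a z @^-1` N).
have maff := measurable_affine_rV a z.
split; first by rewrite -[X in measurable X]setTI; exact: maff.
  move: N0; rewrite (lebesgue_rV_affine z a0)// => /eqP; rewrite mule_eq0.
  by rewrite eqe expf_eq0 normr_eq0 (negPf a0) andbF => /eqP.
by move=> x /= Px; apply: PN.
Qed.

End affine_change_rV.

(** * Density of closed boxes in L^2 and continuity of affine changes of variables *)

Section sqint_limits.
Context {d : measure_display} {T : measurableType d} {R : realType}.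
Variable mu : {measure set T -> \bar R}.

(** Dominated convergence in L^2: [f] and [f_ n] are both at most [h] in absolute value, so the
    squared difference is at most [4 h^2]. *)
Lemma sqint_dominated (f_ : nat -> T -> R) (f h : T -> R) :
  (forall n, measurable_fun setT (f_ n)) -> measurable_fun setT f ->
  (forall x, f_ n x @[n --> \oo] --> f x) -> sqint mu h ->
  (forall n x, `|f_ n x| <= h x) ->
  [/\ sqint mu f, forall n, sqint mu (f_ n) &
   ip mu (fun x => f x - f_ n x) (fun x => f x - f_ n x) @[n --> \oo] --> 0].
Proof.
move=> mf_ mf f_f [mh ih] fh.
have fleh x : `|f x| <= h x.
  have fx : `|f_ n x| @[n --> \oo] --> `|f x| by apply: cvg_norm; exact: f_f.
  rewrite -(cvg_lim _ fx)//.
  by apply: limr_le; [apply/cvg_ex; eexists; exact: fx|exact: nearW].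
have sq (g : T -> R) : measurable_fun setT g -> (forall x, `|g x| <= h x) -> sqint mu g.
  move=> mg gh; split => //; apply: (integ_le _ ih); first exact: measurable_funX.
  by move=> x; rewrite normrX lerXn2r ?nnegrE// (le_trans _ (gh x)).
split; [exact: sq|by move=> n; exact: sq|].
have -> : (0 : R) = \int[mu]_x cst 0 x by rewrite /Rintegral integral0.
apply: (dominated_Rint (f := cst 0) (g := fun x => 4 * h x ^+ 2)
  (f_ := fun n x => (f x - f_ n x) * (f x - f_ n x)) _ _ _ _ _).2 => //.
- by move=> n; apply: measurable_funM; apply: measurable_funB.
- move=> x; rewrite -[cst 0 x](mulr0 0) -(subrr (f x)).
  by apply: cvgM; apply: cvgB => //; exact: cvg_cst.
- exact: integZ.
- move=> n x; rewrite normrM -expr2.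
  have -> : 4 * h x ^+ 2 = (h x + h x) ^+ 2 by ring.
  have h0 : 0 <= h x by rewrite (le_trans _ (fleh x)).
  by rewrite lerXn2r ?nnegrE ?addr_ge0// (le_trans (ler_normB _ _))// lerD.
Qed.

End sqint_limits.

(** * From closed boxes to all of L^2 *)

Section sqint_induction.
Context {R : realType} (n : nat).
Local Notation mu := (@lebesgue_rV R n).
Implicit Types (l u : 'rV[R]_n).

(** Closed boxes form a generating pi-system, and each is a decreasing limit of slightly larger
    closed boxes; the second fact is what continuity of dilations needs. *)
Definition cbox l u : set 'rV[R]_n :=
  box_rV (fun i => `[l ord0 i, u ord0 i]%classic).

Definition cboxes : set (set 'rV[R]_n) := [set B | exists l u, B = cbox l u].

Lemma measurable_cbox l u : measurable (cbox l u).
Proof. by apply: measurable_box_rV => i; exact: measurable_itv. Qed.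

Lemma cboxE l u x : cbox l u x <-> forall i, l ord0 i <= x ord0 i <= u ord0 i.
Proof. by split => H i; have := H i; rewrite /= in_itv. Qed.

Lemma cboxI l u l' u' : cbox l u `&` cbox l' u' =
  cbox (\row_i Num.max (l ord0 i) (l' ord0 i))
       (\row_i Num.min (u ord0 i) (u' ord0 i)).
Proof.
apply/seteqP; split => x.
  move=> [/cboxE H /cboxE H']; apply/cboxE => i; rewrite !mxE ge_max le_min.
  by move: (H i) (H' i) => /andP[? ?] /andP[? ?]; apply/andP; split; apply/andP.
move=> /cboxE H; split; apply/cboxE => i; have := H i; rewrite !mxE ge_max le_min;
  by move=> /andP[/andP[? ?] /andP[? ?]]; apply/andP.
Qed.

Lemma cube_cbox k : @cube R n k = cbox (const_mx (- k%:R)) (const_mx k%:R).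
Proof. by apply/seteqP; split => x H i; have := H i; rewrite /= !mxE. Qed.

Lemma measurable_rV_cboxes : measurable = <<s cboxes >>.
Proof.
apply/seteqP; split; last first.
  apply: smallest_sub; first exact: sigma_algebra_measurable.
  by move=> _ [l [u ->]]; exact: measurable_cbox.
have [s0 sC sU] := smallest_sigma_algebra [set: 'rV[R]_n] cboxes.
apply: smallest_sub; first exact: smallest_sigma_algebra.
rewrite -bigcup_seq/=; apply: bigcup_sub => i _ _ [Y mY <-]; rewrite setTI.
have {mY} : <<s @RGenCInfty.G R >> Y.
  have : (@ocitv R).-sigma.-measurable Y by [].
  by rewrite RGenCInfty.measurableE.
suff : <<s @RGenCInfty.G R >> `<=` [set Y |
   <<s cboxes >> ((fun x : 'rV[R]_n => x ord0 i : measurableTypeR R) @^-1` Y)].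
  exact.
apply: smallest_sub.
  split => /=.
  - by rewrite preimage_set0.
  - by move=> A; rewrite setTD -preimage_setC -[~` (_ @^-1` A)]setTD => /sC.
  - by move=> F HF; rewrite preimage_bigcup; exact: sU.
move=> _ [y ->] /=.
(* The half-space [y <= x_i] is the union over [k] of the boxes with side [[y, k]] in direction [i]
   and [[-k, k]] in the others. *)
rewrite (_ : _ @^-1` _ = \bigcup_k cbox
   (\row_j if j == i then y else - k%:R) (const_mx k%:R)); last first.
  apply/seteqP; split => x.
    rewrite /= in_itv/= andbT => yx.
    have : (\bigcup_k @cube R n k) x by rewrite bigcup_cube.
    move=> [k _ kx]; exists k => //; apply/cboxE => j; rewrite !mxE.
    have := kx j; rewrite /= in_itv/= => /andP[? ?].
    by case: eqP => [ji|_]; apply/andP; split => //; rewrite ji.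
  move=> [k _ /cboxE /(_ i)]; rewrite !mxE eqxx => /andP[? _].
  by rewrite /= in_itv/= andbT.
by apply: sU => k; apply: sub_sigma_algebra; do 2 eexists.
Qed.

Variable P : ('rV[R]_n -> R) -> Prop.
Hypothesis Pbox : forall l u, P (\1_(cbox l u)).
Hypothesis PD : forall f g, sqint mu f -> sqint mu g -> P f -> P g ->
  P (fun x => f x + g x).
Hypothesis PZ : forall k f, sqint mu f -> P f -> P (fun x => k * f x).
Hypothesis Pcl : forall f, sqint mu f -> (forall e, 0 < e -> exists g,
  [/\ sqint mu g, P g & ip mu (fun x => f x - g x) (fun x => f x - g x) < e]) ->
  P f.

Let sqint_indicI A k : measurable A -> sqint mu (\1_(A `&` @cube R n k)).
Proof.
move=> mA; have mk := @measurable_cube R n k; apply: sqint_indic.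
  exact: measurableI.
apply: le_lt_trans (lebesgue_rV_cube_lty n k).
by apply: le_measure; rewrite ?inE//; exact: measurableI.
Qed.

Let Pdom (f_ : nat -> 'rV[R]_n -> R) (f h : 'rV[R]_n -> R) :
  (forall m, measurable_fun setT (f_ m)) -> measurable_fun setT f ->
  (forall x, f_ m x @[m --> \oo] --> f x) -> sqint mu h ->
  (forall m x, `|f_ m x| <= h x) -> (forall m, P (f_ m)) -> P f.
Proof.
move=> mf_ mf f_f sh fh Pf.
have [sf sf_ /cvgrPdist_lt H] := sqint_dominated mf_ mf f_f sh fh.
apply: Pcl => // e e0; have [m _ Hm] := H _ e0; exists (f_ m); split => //.
have := Hm m (leqnn m); rewrite sub0r normrN; apply: le_lt_trans.
exact: ler_norm.
Qed.

(** Dynkin's lemma, starting from boxes. Intersecting with a cube keeps the indicators in L^2 when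
    complements are taken. *)
Let P_indic k A : measurable A -> P (\1_(A `&` @cube R n k)).
Proof.
rewrite {1}measurable_rV_cboxes.
apply: (dynkin_induction (P := fun A => P (\1_(A `&` @cube R n k)))) => //.
- exact: measurable_rV_cboxes.
- by move=> _ _ [l [u ->]] [l' [u' ->]]; rewrite cboxI; do 2 eexists.
- by rewrite setTI cube_cbox.
- by move=> _ [l [u ->]] /=; rewrite cube_cbox cboxI.
- move=> S mS PS.
  have -> : \1_(~` S `&` @cube R n k) =
      (fun x => \1_(setT `&` @cube R n k) x +
         (-1) * \1_(S `&` @cube R n k) x) :> (_ -> R).
    apply/funext => x; rewrite !indicI indicT indicC/= !indicE/= mul1r.
    by case: (x \in S); rewrite /= ?mul0r ?mul1r ?mulr0; ring.
  apply: PD; [exact: sqint_indicI|exact/sqintZ/sqint_indicI|by rewrite setTI cube_cbox|].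
  by apply: PZ => //; exact: sqint_indicI.
- move=> F mF tF PF.
  (* Partial unions grow by one disjoint set at a time, so their indicators are sums. They converge
     pointwise and stay below the indicator of the cube. *)
  pose B m := \big[setU/set0]_(j < m) F j.
  have mB m : measurable (B m) by apply: bigsetU_measurable => j _.
  have PB m : P (\1_(B m `&` @cube R n k)).
    elim: m => [|m IH].
      rewrite /B big_ord0 set0I indic0.
      have := PZ 0 (sqint_indicI k measurableT).
      rewrite setTI cube_cbox => /(_ (Pbox _ _)).
      by congr P; apply/funext => x; rewrite mul0r.
    have -> : \1_(B m.+1 `&` @cube R n k) =
      (fun x => \1_(B m `&` @cube R n k) x + \1_(F m `&` @cube R n k) x) :> (_ -> R).
      apply/funext => x; rewrite !indicI/= -mulrDl; congr (_ * _).
      rewrite /B big_ord_recr/= -/(B m) !indicE in_setU.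
      have [xB|xB] := boolP (x \in B m); have [xF|xF] := boolP (x \in F m) => //=.
        rewrite !inE in xB xF; move: xB; rewrite /B -bigcup_mkord => -[j /= jm Fjx].
        have := tF j m I I (ex_intro _ x (conj Fjx xF)) => jm'.
        by rewrite jm' ltnn in jm.
      1-3: by rewrite ?addr0 ?add0r.
    by apply: PD => //; exact: sqint_indicI.
  apply: (Pdom (f_ := fun m => \1_(B m `&` @cube R n k))
      (h := \1_(setT `&` @cube R n k))) => //.
  + by move=> m; case: (sqint_indicI k (mB m)).
  + by case: (sqint_indicI k (bigcupT_measurable F mF)).
  + move=> x; rewrite indicI; under eq_cvg do rewrite indicI/=.
    apply: cvgMl; rewrite !indicE.
    have [xF|xF] := boolP (x \in \bigcup_k0 F k0).
      move: xF; rewrite inE => -[j _ Fjx].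
      apply: cvg_near_cst; exists j.+1 => // m /= jm.
      by rewrite indicE mem_set// /B -bigcup_mkord; exists j.
    apply: cvg_near_cst; apply: nearW => m.
    rewrite indicE memNset// /B -bigcup_mkord => -[j _ Fjx].
    by move: xF; rewrite notin_setE; apply; exists j.
  + exact: sqint_indicI.
  + move=> m x; rewrite !indicI/= !indicE in_setT mul1r.
    by case: (_ \in _); case: (_ \in _); rewrite /= ?mul0r ?mulr0 ?mulr1 ?normr0 ?normr1.
Qed.

Import HBNNSimple.

Let P_ge0 f : sqint mu f -> (forall x, 0 <= f x) -> P f.
Proof.
move=> sf f0; have mf : measurable_fun setT (EFin \o f).
  by apply/measurable_EFinP; case: sf.
pose g := nnsfun_approx measurableT mf.
(* The cutoff to a cube gives every level set of the simple function [g k] finite measure, including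
   that of the value 0. *)
pose c k : 'rV[R]_n -> R := \1_(setT `&` @cube R n k).
have g_f x : g k x @[k --> \oo] --> f x.
  have := @cvg_nnsfun_approx _ _ R _ measurableT _ mf (fun x _ => f0 x) x I.
  by move=> /fine_cvgP[].
have gle k x : g k x <= f x.
  rewrite -(cvg_lim _ (g_f x))//; apply: (@nondecreasing_cvgn_le _ (fun k => g k x)).
    by move=> i j ij; have /lefP := nd_nnsfun_approx measurableT mf ij; exact.
  by apply/cvg_ex; exists (f x).
have Pgc k : P (fun x => g k x * c k x).
  have -> : (fun x => g k x * c k x) = (fun x =>
    \sum_(y <- finmap.enum_fset (fset_set (range (g k))))
      (y * \1_((g k @^-1` [set y]) `&` @cube R n k) x)).
    apply/funext => x; rewrite /c setTI fimfunE fsbig_finite//= mulr_suml.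
    by apply: eq_bigr => y _; rewrite indicI/= mulrA.
  pose S (s : seq R) x :=
    \sum_(y <- s) (y * \1_((g k @^-1` [set y]) `&` @cube R n k) x).
  have H (s : seq R) : sqint mu (S s) /\ P (S s).
    rewrite /S.
    elim: s => [|y s [IH1 IH2]].
      under eq_fun do rewrite big_nil.
      have := sqintZ 0 (sqint_indicI k measurableT).
      have := PZ 0 (sqint_indicI k measurableT) (P_indic k measurableT).
      by under eq_fun do rewrite mul0r.
    under eq_fun do rewrite big_cons.
    have s1 : sqint mu (\1_((g k @^-1` [set y]) `&` @cube R n k)).
      by apply: sqint_indicI.
    split; first by apply: sqintD => //; exact: sqintZ.
    by apply: PD => //; [exact: sqintZ|apply: PZ => //; exact: P_indic].
  exact: (H _).2.
apply: (Pdom (f_ := fun k x => g k x * c k x) (h := f)) => //.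
- by move=> k; apply: measurable_funM => //; case: (sqint_indicI k measurableT).
- by case: sf.
- move=> x; rewrite -[f x]mulr1; apply: cvgM => //.
  have : (\bigcup_k @cube R n k) x by rewrite bigcup_cube.
  move=> [j _ jx]; apply: cvg_near_cst; exists j => // k /= jk.
  rewrite /c indicE mem_set//; split => // i; have := jx i; rewrite /= !in_itv/=.
  have : j%:R <= k%:R :> R by rewrite ler_nat.
  by move=> ? /andP[? ?]; apply/andP; split; lra.
- move=> k x; rewrite /c indicE; case: (_ \in _); rewrite ?mulr1 ?mulr0 ?normr0//.
  by rewrite ger0_norm.
Qed.

(** Up to the factor [1/2], [f] is the difference of the nonnegative functions [|f| + f] and
    [|f| - f]; each is an L^2 limit of simple functions supported in cubes. *)
Lemma sqint_ind f : sqint mu f -> P f.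
Proof.
move=> sf; have nf := sqint_norm sf.
have -> : f = (fun x => 2^-1 * (`|f x| + f x) + (- 2^-1) * (`|f x| - f x)).
  by apply/funext => x; field.
have s1 : sqint mu (fun x => `|f x| + f x) by exact: sqintD.
have s2 : sqint mu (fun x => `|f x| - f x) by exact: sqintB.
apply: PD; [exact: sqintZ|exact: sqintZ|apply: PZ => //|apply: PZ => //];
  apply: P_ge0 => // x; have := ler_norm (f x); have := lerNnormlW (lexx `|f x|); lra.
Qed.

End sqint_induction.

Lemma ip_sqD_le d (T : measurableType d) (R : realType)
    (mu : {measure set T -> \bar R}) (f g : T -> R) :
  sqint mu f -> sqint mu g ->
  ip mu (fun x => f x + g x) (fun x => f x + g x) <=
  2 * ip mu f f + 2 * ip mu g g.
Proof.
move=> sf sg; rewrite sq_ipD//.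
by have := weighted_cauchy_schwarz ltr01 sf sg; rewrite invr1; lra.
Qed.

(** * Continuity of dilations and translations in L^2 *)

Section affine_continuity.
Context {R : realType} (n : nat).
Local Notation mu := (@lebesgue_rV R n).
Implicit Types (a : R) (z l u : 'rV[R]_n).

Lemma sqint_affine a z (f : 'rV[R]_n -> R) : a != 0 -> sqint mu f ->
  sqint mu (fun x => f (affine_rV a z x)).
Proof.
move=> a0 [mf if2]; split; first exact: measurable_comp_affine.
by have := integ_affine z a0 if2.
Qed.

Lemma ip_affine a z (f g : 'rV[R]_n -> R) : a != 0 ->
  sqint mu f -> sqint mu g ->
  ip mu f g = `|a| ^+ n *
    ip mu (fun x => f (affine_rV a z x)) (fun x => g (affine_rV a z x)).
Proof.
move=> a0 sf sg.
by rewrite /ip (Rint_affine (f := fun x => f x * g x) z a0)//; exact: sqintM.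
Qed.

Lemma cbox_cube l u : exists k, cbox l u `<=` cube (n := n) k.
Proof.
pose M := \sum_(i < n) (`|l ord0 i| + `|u ord0 i|).
have M0 : 0 <= M by apply: sumr_ge0 => i _; exact: addr_ge0.
exists (Num.truncn M).+1 => x /cboxE H i; have /andP[lx xu] := H i.
have := truncnS_gt M; rewrite /= in_itv/=.
have : `|l ord0 i| + `|u ord0 i| <= M.
  by rewrite /M (bigD1 i)//= lerDl sumr_ge0// => j _; exact: addr_ge0.
have := ler_norm (u ord0 i); have := lerNnormlW (lexx `|l ord0 i|).
have := normr_ge0 (u ord0 i); have := normr_ge0 (l ord0 i).
by move=> *; apply/andP; split; lra.
Qed.

Lemma lebesgue_cbox_lty l u : (mu (cbox l u) < +oo)%E.
Proof.
have [k lk] := cbox_cube l u; apply: le_lt_trans (lebesgue_rV_cube_lty n k).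
by apply: le_measure; rewrite ?inE//; [exact: measurable_cbox|exact: measurable_cube].
Qed.

Definition fat l u (k : nat) : set 'rV[R]_n :=
  cbox (l - const_mx k.+1%:R^-1) (u + const_mx k.+1%:R^-1).

(** Continuity of the measure from above, the enlarged boxes having finite measure and intersecting
    in the original one. *)
Lemma fat_cvg l u :
  fine (mu (fat l u k)) @[k --> \oo] --> fine (mu (cbox l u)).
Proof.
have bigE : \bigcap_k fat l u k = cbox l u.
  apply/seteqP; split=> [x H|x /cboxE H k _].
    apply/cboxE => i; apply/andP; split.
      apply/ler_addgt0Pl => e e0; have [k _ ke] := near_infty_natSinv_lt (PosNum e0).
      have /cboxE /(_ i) := H k I; have := ke k (leqnn k).
      rewrite !mxE/= => ke' /andP[lx _].
      move: lx; rewrite lerBlDr => /le_trans; apply.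
      by rewrite addrC lerD2r ltW.
    apply/ler_addgt0Pl => e e0; have [k _ ke] := near_infty_natSinv_lt (PosNum e0).
    have /cboxE /(_ i) := H k I; have := ke k (leqnn k).
    rewrite !mxE/= => ke' /andP[_ xu].
    by rewrite (le_trans xu)// addrC lerD2r ltW.
  apply/cboxE => i; have /andP[? ?] := H i; rewrite !mxE.
  have : 0 < k.+1%:R^-1 :> R by [].
  by move: (k.+1%:R^-1) => h h0; apply/andP; split; lra.
rewrite -bigE; apply: fine_cvg; rewrite fineK; last first.
  by rewrite bigE ge0_fin_numE// lebesgue_cbox_lty.
apply: nonincreasing_cvg_mu.
- exact: lebesgue_cbox_lty.
- by move=> k; exact: measurable_cbox.
- by apply: bigcapT_measurable => k; exact: measurable_cbox.
- move=> j k jk; apply/subsetPset => x /cboxE H; apply/cboxE => i.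
  have := H i; rewrite !mxE.
  have : k.+1%:R^-1 <= j.+1%:R^-1 :> R by rewrite lef_pV2 ?posrE// ler_nat.
  by move: (j.+1%:R^-1) (k.+1%:R^-1) => h h' ? /andP[? ?]; apply/andP; split; lra.
Qed.

(** If [y = a x + z] is in the box then [x_i - y_i = ((1 - a) y_i - z_i) / a] with [|y_i| <= M]. For
    [e = h / (2 (M + 2))] one has [a >= 1/2], hence [|x_i - y_i| <= 2 e (M + 1) <= h], where [h] is
    the amount by which [fat] enlarges the box. *)
Lemma preimage_affine_fat l u k : exists2 e : R, 0 < e & forall a z,
  `|a - 1| < e -> (forall i, `|z ord0 i| < e) ->
  affine_rV a z @^-1` cbox l u `<=` fat l u k.
Proof.
pose M := \sum_(i < n) (`|l ord0 i| + `|u ord0 i|).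
have M0 : 0 <= M by apply: sumr_ge0 => i _; exact: addr_ge0.
pose h : R := k.+1%:R^-1; have h0 : 0 < h by rewrite invr_gt0 ltr0n.
have h1 : h <= 1 by rewrite /h invf_le1 ?ler1n ?ltr0n.
have D0 : 0 < 2 * (M + 2) by lra.
have e0 : 0 < h / (2 * (M + 2)) by rewrite divr_gt0.
exists (h / (2 * (M + 2))) => // a z.
set e := h / _ in e0 *; have eE : e * (2 * (M + 2)) = h by rewrite divfK ?gt_eqF.
have eM : 0 <= e * M by rewrite mulr_ge0// ltW.
rewrite ltr_norml => /andP[a1 a2] ze x /cboxE H; apply/cboxE => i.
have := H i; have := ze i; rewrite !mxE ltr_norml => /andP[z1 z2] /andP[y1 y2].
rewrite -/h; set y := a * _ + _ in y1 y2.
have yM : `|y| <= M.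
  have : `|l ord0 i| + `|u ord0 i| <= M.
    by rewrite /M (bigD1 i)//= lerDl sumr_ge0// => j _; exact: addr_ge0.
  rewrite ler_norml.
  have := ler_norm (u ord0 i); have := lerNnormlW (lexx `|l ord0 i|).
  have := normr_ge0 (u ord0 i); have := normr_ge0 (l ord0 i).
  by move=> *; apply/andP; split; lra.
have a12 : 2^-1 <= a by lra.
have a0 : 0 < a by lra.
suff : `|x ord0 i - y| <= h by rewrite ler_norml => /andP[? ?]; apply/andP; split; lra.
have -> : x ord0 i - y = ((1 - a) * y - z ord0 i) / a.
  by rewrite /y; field; lra.
rewrite normrM normfV (gtr0_norm a0) ler_pdivrMr//.
have : `|(1 - a) * y| <= e * M.
  by rewrite normrM ler_pM// ler_norml; apply/andP; split; lra.
have : `|z ord0 i| <= e by rewrite ler_norml; apply/andP; split; lra.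
have := ler_normB ((1 - a) * y) (z ord0 i).
have : h * 2^-1 <= h * a by rewrite ler_pM2l.
nra.
Qed.

Definition affine_near (e : R) a z := `|a - 1| < e /\ forall i, `|z ord0 i| < e.

Lemma affine_near_le e e' a z : e <= e' -> affine_near e a z -> affine_near e' a z.
Proof. by move=> ee' [ae ze]; split => [|i]; exact: lt_le_trans ee'. Qed.

Lemma affine_near_neq0 e a z : e <= 2^-1 -> affine_near e a z -> a != 0.
Proof.
move=> e2 [ae _]; apply/eqP => a0; move: ae; rewrite a0 sub0r normrN normr1.
by move=> /(lt_le_trans) /(_ e2); lra.
Qed.

(** Continuity in L^2 of the affine action on [f] at the identity. The bound [d <= 2^-1] keeps [a]
    away from 0, so that changes of variables are available. *)
Definition affine_continuous (f : 'rV[R]_n -> R) := forall e, 0 < e ->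
  exists d, [/\ 0 < d, d <= 2^-1 & forall a z, affine_near d a z ->
    ip mu (fun x => f (affine_rV a z x) - f x)
          (fun x => f (affine_rV a z x) - f x) < e].

(* The symmetric difference of a box B and its affine preimage B' lies in a
   slightly fatter box F, so it has measure at most 2|F| - |B| - |B'|. *)
Lemma affine_continuous_cbox l u : affine_continuous (\1_(cbox l u)).
Proof.
move=> e e0; set v0 := fine (mu (cbox l u)).
have e4 : 0 < e / 4 by rewrite divr_gt0.
have : fine (mu (fat l u k)) @[k --> \oo] --> v0 by exact: fat_cvg.
move=> /cvgrPdist_lt /(_ _ e4) [k _ /(_ k (leqnn k)) kv].
have [d1 d10 Hd1] := preimage_affine_fat l u k.
(* The affine preimage of the box has measure [v0 / |a|^n]; its distance to [v0] is made smaller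
   than [e / 4]. *)
have : (fun a : R => v0 * (1 - (`|a| ^+ n)^-1)) @ (1 : R) --> v0 * (1 - (`|1| ^+ n)^-1).
  apply: cvgM; first exact: cvg_cst.
  apply: cvgB; first exact: cvg_cst.
  apply: cvgV; first by rewrite normr1 expr1n oner_neq0.
  apply: (@continuous_comp _ _ _ (fun a : R => `|a|) (fun a => a ^+ n)).
    exact: norm_continuous.
  exact: exprn_continuous.
rewrite normr1 expr1n invr1 subrr mulr0 => /cvgrPdist_lt /(_ _ e4).
move=> /nbhs_ballP[d2 /= d20 Hd2].
exists (Num.min (2^-1) (Num.min d1 d2)); split.
- by rewrite !lt_min d10 d20 invr_gt0 ltr0n.
- by rewrite ge_min lexx.
move=> a z azd; have a0 : a != 0.
  by apply: affine_near_neq0 azd; rewrite ge_min lexx.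
have [az1 az2] : affine_near d1 a z.
  by apply: affine_near_le azd; rewrite !ge_min lexx orbT.
have : ball (1 : R) d2 a.
  rewrite /ball/= distrC; apply: (lt_le_trans (proj1 azd)).
  by rewrite !ge_min lexx !orbT.
move=> /Hd2; rewrite /= sub0r normrN => ad2.
have mB := measurable_cbox l u; have mF : measurable (fat l u k) := measurable_cbox _ _.
have By := lebesgue_cbox_lty l u.
have Fy : (mu (fat l u k) < +oo)%E := lebesgue_cbox_lty _ _.
have BK : cbox l u `<=` fat l u k.
  move=> x /cboxE H; apply/cboxE => i; have := H i; rewrite !mxE.
  have : 0 < k.+1%:R^-1 :> R by rewrite invr_gt0 ltr0n.
  by move: (k.+1%:R^-1) => h h0 /andP[? ?]; apply/andP; split; lra.
have KK := Hd1 a z az1 az2.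
have iB : integ mu (\1_(cbox l u)) by exact: integ_indic.
have iF : integ mu (\1_(fat l u k)) by exact: integ_indic.
have iK := integ_affine z a0 iB.
have vK : \int[mu]_x \1_(cbox l u) (affine_rV a z x) = v0 * (`|a| ^+ n)^-1.
  have := Rint_affine z a0 iB; rewrite Rint_indic// -/v0 => ->.
  by rewrite mulrAC divff ?mul1r// expf_neq0// normr_eq0.
(* The majorant has integral [2 (|F| - v0) + (v0 - v0 / |a|^n) < 3 e / 4]. *)
apply: (@le_lt_trans _ _ (\int[mu]_x
    (2 * \1_(fat l u k) x - \1_(cbox l u) x - \1_(cbox l u) (affine_rV a z x)))).
  have sB : sqint mu (\1_(cbox l u)) by exact: sqint_indic.
  apply: le_Rint.
  - by apply: sqintM; apply: sqintB => //; exact: sqint_affine.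
  - by apply: integB => //; apply: integB => //; exact: integZ.
  move=> x; rewrite !indicE.
  have [xB|xB] := boolP (x \in cbox l u);
  have [xK|xK] := boolP (affine_rV a z x \in cbox l u);
  have [xF|xF] := boolP (x \in fat l u k) => /=; try lra.
  - by move: xF; rewrite notin_setE; have := BK x; rewrite inE in xB => /(_ xB).
  - by move: xF; rewrite notin_setE; have := BK x; rewrite inE in xB => /(_ xB).
  - by move: xF; rewrite notin_setE; have := KK x; rewrite inE in xK => /(_ xK).
rewrite RintB//; last by apply: integB => //; exact: integZ.
rewrite RintB//; last exact: integZ.
rewrite RintZ// vK !Rint_indic// -/v0.
move: ad2 kv; rewrite -/v0 mulrBr mulr1 !ltr_norml => /andP[_ ?] /andP[? ?].
lra.
Qed.

Lemma sqint_affine_continuous f : sqint mu f -> affine_continuous f.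
Proof.
apply: sqint_ind => {f}.
- exact: affine_continuous_cbox.
- move=> f g sf sg Pf Pg e e0.
  have e4 : 0 < e / 4 by rewrite divr_gt0.
  have [d1 [d10 d12 H1]] := Pf _ e4; have [d2 [d20 d22 H2]] := Pg _ e4.
  exists (Num.min d1 d2); split; [by rewrite lt_min d10|by rewrite ge_min d12|].
  move=> a z azd; have az1 : affine_near d1 a z.
    by apply: affine_near_le azd; rewrite ge_min lexx.
  have az2 : affine_near d2 a z by apply: affine_near_le azd; rewrite ge_min lexx orbT.
  have a0 := affine_near_neq0 d12 az1.
  have := H1 _ _ az1; have := H2 _ _ az2.
  have := @ip_sqD_le _ _ _ mu (fun x => f (affine_rV a z x) - f x)
    (fun x => g (affine_rV a z x) - g x)
    (sqintB (sqint_affine z a0 sf) sf) (sqintB (sqint_affine z a0 sg) sg).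
  under [X in X <= _ -> _]eq_Rintegral do rewrite addrACA -opprD.
  rewrite /ip; lra.
- move=> k f sf Pf e e0.
  have k0 : 0 < k ^+ 2 + 1 by rewrite ltr_wpDl// sqr_ge0.
  have [d [d0 d2 H]] := Pf _ (divr_gt0 e0 k0).
  exists d; split => // a z azd; have a0 := affine_near_neq0 d2 azd.
  have sff := sqintB (sqint_affine z a0 sf) sf.
  have := H _ _ azd; rewrite ltr_pdivlMr// => {}H.
  under [X in X < _]eq_Rintegral do rewrite -mulrBr.
  rewrite -/(ip mu _ _) (ipZl k sff (sqintZ k sff)) ipZr//.
  apply: le_lt_trans H; rewrite mulrC mulrAC -expr2.
  by rewrite mulrC ler_wpM2l ?ip_ge0// lerDl.
move=> f sf Hf e e0.
(* With [f_a - f = (f_a - g_a) + (g_a - g) + (g - f)], the squared norm is at most [4 + 4 + 2] times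
   [e / 12]. The factor [2^n] pays for the dilation in the first term, since [|a| >= 1/2]. *)
have en : 0 < e / (12 * 2 ^+ n) by rewrite divr_gt0// mulr_gt0// exprn_gt0.
have [g [sg Pg fg]] := Hf _ en.
have e12 : 0 < e / 12 by rewrite divr_gt0.
have [d [d0 d2 H]] := Pg _ e12.
exists d; split => // a z azd; have a0 := affine_near_neq0 d2 azd.
have sfa := sqint_affine z a0 sf; have sga := sqint_affine z a0 sg.
have sfg := sqintB sf sg; have sgg := sqintB sga sg.
have sfga := sqintB sfa sga; have sgf := sqintB sg sf.
have h1 : ip mu (fun x => g x - f x) (fun x => g x - f x) < e / 12.
  have -> : ip mu (fun x => g x - f x) (fun x => g x - f x) =
      ip mu (fun x => f x - g x) (fun x => f x - g x).
    by apply: eq_Rintegral => x _; rewrite -mulrNN !opprB.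
  apply: (lt_le_trans fg); rewrite ler_pM2l// lef_pV2 ?qualifE/= ?mulr_gt0 ?exprn_gt0//.
  by rewrite ler_peMr ?exprn_ege1 ?ler1n.
have h2 : ip mu (fun x => f (affine_rV a z x) - g (affine_rV a z x))
    (fun x => f (affine_rV a z x) - g (affine_rV a z x)) < e / 12.
  move: fg; rewrite (ip_affine z a0 sfg sfg) => fg.
  have [a1 _] := azd.
  have a2 : 2^-1 <= `|a|.
    have : `|1| <= `|1 - a| + `|a| by have := ler_normD (1 - a) a; rewrite subrK.
    by rewrite normr1 distrC; have := lt_le_trans a1 d2; lra.
  have an : (2 ^+ n)^-1 <= `|a| ^+ n by rewrite -exprVn lerXn2r// nnegrE.
  set I := ip _ _ _ in fg *; have I0 : 0 <= I by exact: ip_ge0.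
  have : (2 ^+ n)^-1 * I < e / (12 * 2 ^+ n).
    by apply: le_lt_trans fg; rewrite ler_wpM2r.
  by rewrite invfM mulrA [e / 12 * _]mulrC ltr_pM2l// invr_gt0 exprn_gt0.
have h3 := H _ _ azd.
have := ip_sqD_le (sqintD sfga sgg) sgf; have := ip_sqD_le sfga sgg.
under [X in _ -> ip mu X _ <= _ -> _]eq_fun do rewrite subrKA subrKA.
under [X in _ -> ip mu _ X <= _ -> _]eq_fun do rewrite subrKA subrKA.
rewrite /ip in h1 h2 h3 *; lra.
Qed.

End affine_continuity.

(** * An explicit Fourier pair *)

Section kernel1.
Context {R : realType}.
Local Notation mu := (@lebesgue_measure R).
Implicit Types z s : R.

(** An even function is integrated over the half-line by the fundamental theorem of calculus. The
    primitive belongs to [g], which equals [f] only for [s >= 0]: this allows functions of [|s|]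
    that are not differentiable at 0. *)
Lemma even_integral (f g F : R -> R) (l : R) :
  (forall s, 0 <= f s) -> continuous f -> (forall s, f s = f (- s)) ->
  (forall s, is_derive s (1 : R) F (g s)) -> (forall s, 0 <= s -> f s = g s) ->
  F s @[s --> +oo] --> l ->
  integ mu f /\ \int[mu]_s f s = 2 * (l - F 0).
Proof.
move=> f0 cf fE dF fg Fl.
have mf : measurable_fun setT f by exact: continuous_measurable_fun.
have H : (\int[mu]_s (f s)%:E = (2 * (l - F 0))%:E)%E.
  have H0 : (\int[mu]_(s in `[0%R, +oo[) (f s)%:E = l%:E - (F 0)%:E)%E.
    apply: ge0_continuous_FTC2y => //.
    - exact: continuous_subspaceT.
    - apply: cvg_at_right_filter; apply: differentiable_continuous.
      by apply/derivable1_diffP; have [] := dF 0.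
    - move=> x; rewrite in_itv/= andbT => x0; rewrite derive1E fg ?ltW//.
      by have [_ ->] := dF x.
  by rewrite ge0_symfun_integralT// -set_itvcy H0.
split; last by rewrite /Rintegral H.
by apply: ge0_integP => //; rewrite H ltry.
Qed.

Definition expabs s : R := expR (- `|s|).

Lemma continuous_expabs : continuous expabs.
Proof.
move=> s; apply: (@continuous_comp _ _ _ (fun s => - `|s|) expR).
  apply: continuousN; exact: norm_continuous.
exact: continuous_expR.
Qed.

Lemma expabs_integral : integ mu expabs /\ \int[mu]_s expabs s = 2.
Proof.
have [|||s|s s0||-> ->] := @even_integral expabs (fun s => expR (- s))
  (fun s => - expR (- s)) 0.
- by move=> s; exact: expR_ge0.
- exact: continuous_expabs.
- by move=> s; rewrite /expabs normrN.
- by apply: is_derive_eq; rewrite mulrN1 opprK.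
- by rewrite /expabs ger0_norm.
- by rewrite -oppr0; apply: cvgN; exact: cvgr_expR.
by rewrite oppr0 expR0; split => //; ring.
Qed.

(** Since [even_integral] wants a nonnegative integrand, [1 + cos] takes the place of [cos], and the
    integral of [expabs] is subtracted afterwards. *)
Lemma cos_expabs_integral z : integ mu (fun s => cos (z * s) * expabs s) /\
  \int[mu]_s (cos (z * s) * expabs s) = 2 / (1 + z ^+ 2).
Proof.
have z2 : 0 < 1 + z ^+ 2 by rewrite ltr_pwDl// sqr_ge0.
have [|||s|s s0||] := @even_integral (fun s => (1 + cos (z * s)) * expabs s)
  (fun s => (1 + cos (z * s)) * expR (- s))
  (fun s => expR (- s) * ((z * sin (z * s) - cos (z * s)) / (1 + z ^+ 2) - 1)) 0.
- move=> s; rewrite mulr_ge0 ?expR_ge0//; have := cos_geN1 (z * s); lra.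
- move=> s; apply: cvgM; last exact: continuous_expabs.
  apply: cvgD; first exact: cvg_cst.
  apply: (@continuous_comp _ _ _ (fun s => z * s) cos); last exact: continuous_cos.
  by apply: cvgM; [exact: cvg_cst|exact: cvg_id].
- by move=> s; rewrite /expabs normrN mulrN cosN.
- apply: is_derive_eq; rewrite /GRing.scale/=; field; lra.
- by rewrite /expabs ger0_norm.
- pose C := (`|z| + 1) / (1 + z ^+ 2) + 1.
  have Cs s : `|(z * sin (z * s) - cos (z * s)) / (1 + z ^+ 2) - 1| <= C.
    rewrite (le_trans (ler_normB _ _))// normr1 lerD2r normrM normfV (gtr0_norm z2).
    rewrite ler_pM2r ?invr_gt0// (le_trans (ler_normB _ _))// lerD//.
      by rewrite normrM ler_piMr// ler_norml sin_geN1 sin_le1.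
    by rewrite ler_norml cos_geN1 cos_le1.
  apply/norm_cvg0P; apply: (@squeeze_cvgr _ _ _ _ (cst 0) (fun s => expR (- s) * C)).
  + apply: nearW => s; rewrite normr_ge0/= normrM ger0_norm ?expR_ge0//.
    by rewrite ler_wpM2l ?expR_ge0.
  + exact: cvg_cst.
  + rewrite -[X in _ --> X](mul0r C).
    by apply: cvgM; [exact: cvgr_expR|exact: cvg_cst].
move=> i1 I1; have [i0 I0] := expabs_integral.
have E s : (1 + cos (z * s)) * expabs s - expabs s = cos (z * s) * expabs s by ring.
have := integB i1 i0; have := RintB i1 i0.
under eq_Rintegral do rewrite E.
move=> ->; under eq_fun do rewrite E.
move=> ?; split => //; rewrite I0 I1 mulr0 cos0 sin0 oppr0 expR0.
by field; lra.
Qed.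

Lemma cauchy_integral : integ mu (fun s => 2 / (1 + s ^+ 2)) /\
  \int[mu]_s (2 / (1 + s ^+ 2)) = 2 * pi.
Proof.
have p s : 0 < 1 + s ^+ 2 by rewrite ltr_pwDl// sqr_ge0.
have dF s : is_derive s (1 : R) (fun s => 2 * atan s) (2 / (1 + s ^+ 2)).
  exact: is_deriveZ.
suff : integ mu (fun s => 2 / (1 + s ^+ 2)) /\
    \int[mu]_s (2 / (1 + s ^+ 2)) = 2 * (pi - 2 * atan (0 : R)).
  by rewrite atan0 mulr0 subr0.
apply: (even_integral _ _ _ dF) => //.
- by move=> s; rewrite divr_ge0 ?ltW.
- move=> s; apply: cvgM; first exact: cvg_cst.
  exact: continuous_oneDsqrV.
- by move=> s; rewrite sqrrN.
- have -> : pi = 2 * (pi / 2) :> R by field.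
  by apply: cvgM; [exact: cvg_cst|exact: cvgy_atan].
Qed.

End kernel1.

(** * Splitting off the first coordinate in integrals *)

Section rV_products.
Context {R : realType}.
Local Notation mu n := (@lebesgue_rV R n).
Local Notation leb := (@lebesgue_measure R).

Lemma integ_cons_rV n (f : 'rV[R]_n.+1 -> R) : measurable_fun setT f ->
  integ (leb \x mu n)%E (fun p => f (cons_rV p)) ->
  integ (mu n.+1) f /\
  \int[mu n.+1]_x f x = \int[(leb \x mu n)%E]_p f (cons_rV p).
Proof.
move=> mf ifc; have mc := @measurable_cons_rV R n.
have eqI (g : 'rV[R]_n.+1 -> \bar R) :
    (\int[mu n.+1]_x g x = \int[pushforward (leb \x mu n)%E (@cons_rV R n)]_x g x)%E.
  exact: eq_measure_integral.
have mEf : measurable_fun setT (EFin \o f) by exact/measurable_EFinP.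
split.
  apply/integrableP; split => //; rewrite eqI ge0_integral_pushforward//; last first.
    exact: measurableT_comp.
  by case/integrableP : ifc.
by rewrite /Rintegral eqI integral_pushforward.
Qed.

Lemma Rint_rV0 (f : 'rV[R]_0 -> R) :
  integ (mu 0%N) f /\ \int[mu 0%N]_x f x = f 0.
Proof.
have -> : f = (fun x => f 0 * \1_setT x).
  by apply/funext => x; rewrite indicT mulr1 thinmx0.
have m1 : mu 0%N [set: 'rV[R]_0] = 1%E by rewrite /= diracE in_setT.
have m1y : (mu 0%N [set: 'rV[R]_0] < +oo)%E by rewrite m1 ltry.
have i1 : integ (mu 0%N) (\1_setT) by apply: integ_indic => //; exact: m1y.
have I1 : \int[mu 0]_x \1_[set: 'rV[R]_0] x = 1 :> R.
  by rewrite Rint_indic//; transitivity (fine (1%E : \bar R)); [congr fine; exact: m1|].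
by split; [exact: integZ|rewrite RintZ// I1/= indicT].
Qed.

Lemma integ_cons_prod n (f : 'rV[R]_n.+1 -> R) p q :
  measurable_fun setT f -> integ leb p -> integ (mu n) q ->
  (forall t x, f (cons_rV (t, x)) = p t * q x) ->
  integ (mu n.+1) f /\
  \int[mu n.+1]_x f x = (\int[leb]_t p t) * \int[mu n]_x q x.
Proof.
move=> mf ip iq fpq.
have ifc : integ (leb \x mu n)%E (fun z => f (cons_rV z)).
  apply: (integ_dominated_prod (p := fun t => `|p t|) (q := fun x => `|q x|)).
  - exact: measurableT_comp mf (@measurable_cons_rV R n).
  - exact: integ_norm.
  - exact: integ_norm.
  - by move=> t x; rewrite fpq normrM.
have [i1 ->] := integ_cons_rV mf ifc; split => //.
rewrite -(integ_fubini1 ifc).2.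
under eq_Rintegral => t _.
  under eq_Rintegral do rewrite fpq.
  by rewrite RintZ// mulrC; over.
by rewrite RintZ// mulrC.
Qed.

End rV_products.

Section measurable_dot.
Context {R : realType} {n : nat}.

Lemma measurable_dot d (T : measurableType d) (f g : T -> 'rV[R]_n) :
  measurable_fun setT f -> measurable_fun setT g ->
  measurable_fun setT (fun x => dot (f x) (g x)).
Proof.
move=> mf mg; apply: measurable_sum => i.
by apply: measurable_funM; exact: measurableT_comp (measurable_coord i) _.
Qed.

Lemma dotDl (x y z : 'rV[R]_n) : dot (x + y) z = dot x z + dot y z.
Proof. by rewrite /dot -big_split/=; apply: eq_bigr => i _; rewrite mxE mulrDl. Qed.

Lemma dotC (x y : 'rV[R]_n) : dot x y = dot y x.
Proof. by apply: eq_bigr => i _; rewrite mulrC. Qed.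

Lemma dotZl a (x y : 'rV[R]_n) : dot (a *: x) y = a * dot x y.
Proof. by rewrite /dot mulr_sumr; apply: eq_bigr => i _; rewrite mxE mulrA. Qed.

Lemma dotZr a (x y : 'rV[R]_n) : dot x (a *: y) = a * dot x y.
Proof. by rewrite dotC dotZl dotC. Qed.

Lemma dotNl (x y : 'rV[R]_n) : dot (- x) y = - dot x y.
Proof. by rewrite -scaleN1r dotZl mulN1r. Qed.

Lemma dotNr (x y : 'rV[R]_n) : dot x (- y) = - dot x y.
Proof. by rewrite dotC dotNl dotC. Qed.

End measurable_dot.

(** * The damping factor and its Fourier transform *)

Section kernel_rV.
Context {R : realType}.
Local Notation mu n := (@lebesgue_rV R n).
Local Notation leb := (@lebesgue_measure R).

Lemma dot_cons n (t s : R) (x y : 'rV[R]_n) :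
  dot (cons_rV (t, x)) (cons_rV (s, y)) = t * s + dot x y.
Proof.
rewrite /dot big_ord_recl !cons_rV0/=; congr (_ + _).
by apply: eq_bigr => i _; rewrite !cons_rVS.
Qed.

Lemma cons_rV_eta n (x : 'rV[R]_n.+1) :
  x = cons_rV (x ord0 ord0, \row_i x ord0 (lift ord0 i)).
Proof.
apply/rowP => i; case: (unliftP ord0 i) => [j|] ->.
  by rewrite [RHS]cons_rVS mxE.
by rewrite [RHS]cons_rV0.
Qed.

Definition damping n (x : 'rV[R]_n) : R := \prod_(i < n) expabs (x ord0 i).

Definition kernel n (x : 'rV[R]_n) : R := \prod_(i < n) (2 / (1 + x ord0 i ^+ 2)).

Lemma measurable_damping n : measurable_fun setT (@damping n).
Proof.
apply: measurable_prod => i _.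
exact: (measurableT_comp (continuous_measurable_fun continuous_expabs) (measurable_coord i)).
Qed.

Lemma measurable_kernel n : measurable_fun setT (@kernel n).
Proof.
apply: measurable_prod => i _.
exact: (measurableT_comp (integ_measurable (@cauchy_integral R).1) (measurable_coord i)).
Qed.

Lemma damping_cons n t (x : 'rV[R]_n) :
  damping (cons_rV (t, x)) = expabs t * damping x.
Proof.
rewrite /damping big_ord_recl !cons_rV0; congr (_ * _).
by apply: eq_bigr => i _; rewrite !cons_rVS.
Qed.

Lemma kernel_cons n t (x : 'rV[R]_n) :
  kernel (cons_rV (t, x)) = 2 / (1 + t ^+ 2) * kernel x.
Proof.
rewrite /kernel big_ord_recl !cons_rV0; congr (_ * _).
by apply: eq_bigr => i _; rewrite !cons_rVS.
Qed.

Lemma damping_ge0 n (x : 'rV[R]_n) : 0 <= damping x.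
Proof. by apply: prodr_ge0 => i _; exact: expR_ge0. Qed.

Lemma kernel_ge0 n (x : 'rV[R]_n) : 0 <= kernel x.
Proof. by apply: prodr_ge0 => i _; rewrite divr_ge0// addr_ge0// sqr_ge0. Qed.

Lemma dampingN n (x : 'rV[R]_n) : damping (- x) = damping x.
Proof. by apply: eq_bigr => i _; rewrite mxE /expabs normrN. Qed.

Lemma kernel_integral n :
  integ (mu n) (@kernel n) /\ \int[mu n]_x kernel x = (2 * pi) ^+ n.
Proof.
elim: n => [|n [IH1 IH2]].
  by have [i1 ->] := Rint_rV0 (@kernel 0); rewrite /kernel big_ord0.
have [c1 c2] := @cauchy_integral R.
have [i1 ->] := integ_cons_prod (@measurable_kernel n.+1) c1 IH1 (@kernel_cons n).
by rewrite c2 IH2 exprS.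
Qed.

Lemma integ_damping n : integ (mu n) (@damping n).
Proof.
elim: n => [|n IH]; first by have [] := Rint_rV0 (@damping 0).
have [c1 _] := @expabs_integral R.
by have [] := integ_cons_prod (@measurable_damping n.+1) c1 IH (@damping_cons n).
Qed.

(** The substitution [x -> - x] turns the integral into its opposite. *)
Lemma Rint_odd n (f : 'rV[R]_n -> R) : integ (mu n) f ->
  (forall x, f (- x) = - f x) -> \int[mu n]_x f x = 0.
Proof.
move=> mf fN; have n1 : (-1 : R) != 0 by rewrite oppr_eq0 oner_neq0.
have := Rint_affine 0 n1 mf; rewrite normrN1 expr1n mul1r.
under [RHS]eq_Rintegral do rewrite /affine_rV addr0 scaleN1r fN -mulN1r.
rewrite RintZ//; lra.
Qed.

(** Induction on [n] with [cos (p + q) = cos p cos q - sin p sin q], where [p] comes from the first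
    coordinate and [q] from the others. Each product integrates to a product, and the sine term
    vanishes by oddness. *)
Lemma damping_fourier n (z : 'rV[R]_n) :
  [/\ integ (mu n) (fun x => cos (dot z x) * damping x),
      integ (mu n) (fun x => sin (dot z x) * damping x),
      \int[mu n]_x (sin (dot z x) * damping x) = 0 &
      \int[mu n]_x (cos (dot z x) * damping x) = kernel z].
Proof.
have mdot m (y : 'rV[R]_m) : measurable_fun setT (fun x : 'rV[R]_m => dot y x).
  exact: measurable_dot.
have mcos m (y : 'rV[R]_m) : measurable_fun setT (fun x : 'rV[R]_m => cos (dot y x)).
  exact: (measurableT_comp (continuous_measurable_fun (@continuous_cos R)) (mdot m y)).
have msin m (y : 'rV[R]_m) : measurable_fun setT (fun x : 'rV[R]_m => sin (dot y x)).
  exact: (measurableT_comp (continuous_measurable_fun (@continuous_sin R)) (mdot m y)).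
have icos m (y : 'rV[R]_m) : integ (mu m) (fun x => cos (dot y x) * damping x).
  apply: (integ_bounded (k := 1) _ (integ_damping m)) => [|x]; first exact: mcos.
  by rewrite ler_norml cos_geN1 cos_le1.
have isin m (y : 'rV[R]_m) : integ (mu m) (fun x => sin (dot y x) * damping x).
  apply: (integ_bounded (k := 1) _ (integ_damping m)) => [|x]; first exact: msin.
  by rewrite ler_norml sin_geN1 sin_le1.
have sin0 m (y : 'rV[R]_m) : \int[mu m]_x (sin (dot y x) * damping x) = 0.
  by apply: Rint_odd => // x; rewrite dotNr dampingN sinN mulNr.
split => //; elim: n z => [|n IH] z.
  rewrite (Rint_rV0 _).2 /kernel /damping /dot !big_ord0.
  by rewrite cos0 mul1r.
rewrite [z]cons_rV_eta; set t := z ord0 ord0; set y := \row_i _.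
have [c1 c2] := cos_expabs_integral t; have [e1 _] := @expabs_integral R.
have s1 : integ leb (fun s => sin (t * s) * expabs s).
  apply: (integ_bounded (k := 1) _ e1) => [|s].
    apply: (measurableT_comp (continuous_measurable_fun (@continuous_sin R))).
    exact: measurable_funM.
  by rewrite ler_norml sin_geN1 sin_le1.
pose tl (x : 'rV[R]_n.+1) : 'rV[R]_n := \row_i x ord0 (lift ord0 i).
pose g1 (x : 'rV[R]_n.+1) := (cos (t * x ord0 ord0) * expabs (x ord0 ord0)) *
  (cos (dot y (tl x)) * damping (tl x)).
pose g2 (x : 'rV[R]_n.+1) := (sin (t * x ord0 ord0) * expabs (x ord0 ord0)) *
  (sin (dot y (tl x)) * damping (tl x)).
have mrow : measurable_fun setT tl.
  rewrite /tl; apply: measurable_fun_rVP => i; under eq_fun do rewrite mxE.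
  exact: measurable_coord.
have rowE s (x : 'rV[R]_n) : tl (cons_rV (s, x)) = x.
  by apply/rowP => i; rewrite mxE cons_rVS.
have mg1 : measurable_fun setT g1.
  apply: measurable_funM.
    exact: (measurableT_comp (integ_measurable c1) (measurable_coord ord0)).
  exact: (measurableT_comp (integ_measurable (icos n y)) mrow).
have mg2 : measurable_fun setT g2.
  apply: measurable_funM.
    exact: (measurableT_comp (integ_measurable s1) (measurable_coord ord0)).
  exact: (measurableT_comp (integ_measurable (isin n y)) mrow).
have [|i1 I1] := integ_cons_prod mg1 c1 (icos n y).
  by move=> s x; rewrite /g1 cons_rV0 rowE.
have [|i2 I2] := integ_cons_prod mg2 s1 (isin n y).
  by move=> s x; rewrite /g2 cons_rV0 rowE.
rewrite kernel_cons -IH -c2 -I1 -[RHS]subr0.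
rewrite -[X in _ - X](mulr0 (\int[leb]_s (sin (t * s) * expabs s))).
rewrite -(sin0 n y) -I2 -RintB//; apply: eq_Rintegral => x _.
rewrite [x]cons_rV_eta dot_cons damping_cons cosD /g1 /g2.
by rewrite cons_rV0 rowE; ring.
Qed.

End kernel_rV.

(** * Plancherel's theorem for real functions *)

Section plancherel_real.
Context {R : realType} {n : nat}.
Local Notation mu := (@lebesgue_rV R n).
Implicit Types (a : 'rV[R]_n -> R) (x z xi : 'rV[R]_n).

(** For real [a], the Fourier integral before normalization is
    [cos_transform a - i sin_transform a]. *)
Definition cos_transform a xi : R := \int[mu]_x (cos (dot x xi) * a x).
Definition sin_transform a xi : R := \int[mu]_x (sin (dot x xi) * a x).

Definition autocorrelation a z : R := \int[mu]_x (a x * a (affine_rV 1 z x)).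

Lemma measurable_cos_dot d (T : measurableType d) (f g : T -> 'rV[R]_n) :
  measurable_fun setT f -> measurable_fun setT g ->
  measurable_fun setT (fun t => cos (dot (f t) (g t))).
Proof.
move=> mf mg.
exact: (measurableT_comp (continuous_measurable_fun (@continuous_cos R))
  (measurable_dot mf mg)).
Qed.

Lemma measurable_sin_dot d (T : measurableType d) (f g : T -> 'rV[R]_n) :
  measurable_fun setT f -> measurable_fun setT g ->
  measurable_fun setT (fun t => sin (dot (f t) (g t))).
Proof.
move=> mf mg.
exact: (measurableT_comp (continuous_measurable_fun (@continuous_sin R))
  (measurable_dot mf mg)).
Qed.

Lemma normr_cos_le1 (t : R) : `|cos t| <= 1.
Proof. by rewrite ler_norml cos_geN1 cos_le1. Qed.

Lemma normr_sin_le1 (t : R) : `|sin t| <= 1.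
Proof. by rewrite ler_norml sin_geN1 sin_le1. Qed.

Lemma integ_cos_dot a xi : integ mu a -> integ mu (fun x => cos (dot x xi) * a x).
Proof.
move=> ia; apply: (integ_bounded (k := 1) _ ia) => [|x]; last exact: normr_cos_le1.
exact: measurable_cos_dot.
Qed.

Lemma integ_sin_dot a xi : integ mu a -> integ mu (fun x => sin (dot x xi) * a x).
Proof.
move=> ia; apply: (integ_bounded (k := 1) _ ia) => [|x]; last exact: normr_sin_le1.
exact: measurable_sin_dot.
Qed.

Lemma affine_rV1C x z : affine_rV 1 z x = affine_rV 1 x z.
Proof. by rewrite /affine_rV !scale1r addrC. Qed.

Lemma measurable_shift a : measurable_fun setT a ->
  measurable_fun setT (fun p : 'rV[R]_n * 'rV[R]_n => a (affine_rV 1 p.2 p.1)).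
Proof.
move=> ma; apply: (measurableT_comp ma).
apply: measurable_fun_rVP => i.
have -> : (fun p : 'rV[R]_n * 'rV[R]_n => affine_rV 1 p.2 p.1 ord0 i) =
    (fun p => p.1 ord0 i + p.2 ord0 i).
  by apply/funext => p; rewrite /affine_rV scale1r mxE.
apply: measurable_funD; [exact: (measurableT_comp (measurable_coord i) measurable_fst)|].
exact: (measurableT_comp (measurable_coord i) measurable_snd).
Qed.

Lemma Rint_shift z a : integ mu a -> \int[mu]_x a (affine_rV 1 z x) = \int[mu]_x a x.
Proof.
move=> ia; have := Rint_affine z (oner_neq0 R) ia.
by rewrite normr1 expr1n mul1r => ->.
Qed.

Lemma integ_shift z a : integ mu a -> integ mu (fun x => a (affine_rV 1 z x)).
Proof. by move=> ia; exact: integ_affine (oner_neq0 R) ia. Qed.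

(** For fixed [x], translation invariance makes the integral of [|a(x + z)|] over [z] equal to the
    L^1 norm of [a], so the double integral of the absolute value is the square of that norm. *)
Lemma integ_shift_prod a : integ mu a ->
  integ (mu \x mu)%E (fun p => a p.1 * a (affine_rV 1 p.2 p.1)).
Proof.
move=> ia; have na := integ_norm ia; have ma := integ_measurable ia.
apply/integrable12ltyP.
  apply/measurable_EFinP; apply: measurable_funM.
    exact: measurableT_comp ma measurable_fst.
  exact: measurable_shift.
rewrite [X in (X < _)%E](_ : _ =
    (\int[mu]_x (`|a x| * \int[mu]_z `|a z|)%:E)%E); last first.
  apply: eq_integral => x _.
  rewrite (_ : (\int[mu]_z `|a z|)%R = \int[mu]_z `|a (affine_rV 1 x z)|); last first.
    by rewrite (Rint_shift x na).
  have ns := integ_shift x na.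
  rewrite -RintZ// -integ_EFin; last exact: integZ.
  by apply: eq_integral => z _; rewrite /= affine_rV1C normrM.
have i2 := integZ (\int[mu]_z `|a z|) na.
have i3 : integ mu (fun x => `|a x| * \int[mu]_z `|a z|).
  by apply: eq_integ i2 => x; rewrite mulrC.
by rewrite integ_EFin// ltry.
Qed.

Lemma integ_autocorrelation a : integ mu a -> integ mu (autocorrelation a).
Proof. by move=> ia; have [] := integ_fubini2 (integ_shift_prod ia). Qed.

Lemma sqint_shift z a : sqint mu a -> sqint mu (fun x => a (affine_rV 1 z x)).
Proof. exact: sqint_affine (oner_neq0 R). Qed.

Lemma ip_shift z a : sqint mu a ->
  ip mu (fun x => a (affine_rV 1 z x)) (fun x => a (affine_rV 1 z x)) = ip mu a a.
Proof.
move=> sa; have := ip_affine z (oner_neq0 R) sa sa.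
by rewrite normr1 expr1n mul1r => ->.
Qed.

Lemma autocorrelation_le a z : sqint mu a -> `|autocorrelation a z| <= ip mu a a.
Proof.
move=> sa; have ss := sqint_shift z sa.
have := weighted_cauchy_schwarz ltr01 sa ss.
have := weighted_cauchy_schwarz ltr01 (sqintZ (-1) sa) ss.
rewrite !(ipZl, ipZr)//; [|exact: sqintZ].
by rewrite ip_shift// -/(autocorrelation a z) invr1 ler_norml => ? ?;
  rewrite /autocorrelation -/(ip mu a _); apply/andP; split; lra.
Qed.

(** The difference is [<a, a_z - a>] with [z = w / (k + 1)]: Cauchy-Schwarz and continuity of
    translations in L^2. Adding 1 to [ip mu a a] keeps the denominator positive even if [a] vanishes
    almost everywhere. *)
Lemma autocorrelation_cvg0 a (w : 'rV[R]_n) : sqint mu a ->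
  autocorrelation a (k.+1%:R^-1 *: w) @[k --> \oo] --> ip mu a a.
Proof.
move=> sa; apply/cvgrPdist_lt => e e0.
have a1 : 0 < ip mu a a + 1 by rewrite ltr_wpDl// ip_ge0.
have e2 : 0 < e ^+ 2 / (ip mu a a + 1) by rewrite divr_gt0// exprn_gt0.
have [d [d0 d2 H]] := sqint_affine_continuous sa e2.
pose M := \sum_(i < n) `|w ord0 i|.
have M0 : 0 <= M by apply: sumr_ge0.
have dM : 0 < d / (M + 1) by rewrite divr_gt0// ltr_wpDl.
have [k0 _ Hk] := near_infty_natSinv_lt (PosNum dM).
exists k0 => // k /= k0k; have {Hk} := Hk k k0k => /= Hk.
set z := _ *: w.
have az : affine_near d 1 z.
  split=> [|i]; first by rewrite subrr normr0.
  rewrite mxE normrM ger0_norm ?invr_ge0//.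
  have wM : `|w ord0 i| < M + 1.
    by rewrite (@le_lt_trans _ _ M) ?ltrDl// /M (bigD1 i)//= lerDl sumr_ge0.
  move: Hk; rewrite ltr_pdivlMr ?ltr_wpDl//; apply: le_lt_trans.
  by rewrite ler_wpM2l ?invr_ge0// ltW.
have := H 1 z az; have ss := sqint_shift z sa; have sd := sqintB ss sa.
rewrite ltr_pdivlMr// => Hd.
rewrite distrC /autocorrelation -/(ip mu a _) -ipBr//.
rewrite -(ltr_pXn2r (n := 2))// ?nnegrE ?ltW// real_normK ?num_real//.
apply: le_lt_trans Hd; apply: le_trans (cauchy_schwarz_ip sa sd) _.
by rewrite mulrC ler_wpM2l ?ip_ge0// lerDl.
Qed.

(** The Wiener-Khinchin identity: Fubini, the substitution [y = x + z] in the inner integral, and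
    the addition formula for [cos ((y - x) . xi)]. *)
Lemma power_spectrum a xi : integ mu a -> sqint mu a ->
  cos_transform a xi ^+ 2 + sin_transform a xi ^+ 2 =
  \int[mu]_z (cos (dot z xi) * autocorrelation a z).
Proof.
move=> ia sa; have ma := integ_measurable ia.
have iF := integ_shift_prod ia.
pose G (p : 'rV[R]_n * 'rV[R]_n) :=
  cos (dot p.2 xi) * (a p.1 * a (affine_rV 1 p.2 p.1)).
have iG : integ (mu \x mu)%E G.
  apply: (integ_bounded (k := 1) _ iF) => [|p]; last exact: normr_cos_le1.
  by apply: measurable_cos_dot => //; exact: measurable_snd.
have C1 : \int[mu]_z (cos (dot z xi) * autocorrelation a z) =
    \int[mu]_z \int[mu]_x G (x, z).
  apply: eq_Rintegral => z _; rewrite -RintZ//.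
  by apply: sqintM => //; exact: sqint_shift.
rewrite C1 -Rint_fubini//.
have ic := integ_cos_dot xi ia; have is' := integ_sin_dot xi ia.
have C2 x : \int[mu]_z G (x, z) =
    a x * (cos (dot x xi) * cos_transform a xi + sin (dot x xi) * sin_transform a xi).
  have E (y : 'rV[R]_n) : cos (dot (y - x) xi) * a y =
      cos (dot x xi) * (cos (dot y xi) * a y) + sin (dot x xi) * (sin (dot y xi) * a y).
    by rewrite dotDl dotNl cosB; ring.
  have i1 := integZ (cos (dot x xi)) ic; have i2 := integZ (sin (dot x xi)) is'.
  have i3 := integD i1 i2.
  have i4 : integ mu (fun y => cos (dot (y - x) xi) * a y).
    by apply: eq_integ i3 => y; rewrite E.
  transitivity (a x * \int[mu]_z (cos (dot (affine_rV 1 x z - x) xi) * a (affine_rV 1 x z))).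
    rewrite -RintZ; last exact: (integ_shift x i4).
    apply: eq_Rintegral => z _; rewrite /G/= affine_rV1C.
    by rewrite {2}/affine_rV scale1r addrK; ring.
  rewrite (Rint_shift x i4); congr (_ * _).
  under eq_Rintegral do rewrite E.
  by rewrite RintD// !RintZ.
under eq_Rintegral do rewrite C2.
rewrite !expr2 /cos_transform -/(cos_transform a xi) -/(sin_transform a xi).
rewrite -{1}RintZ// -[X in _ + _ * X]/(sin_transform a xi) -RintZ//.
rewrite -RintD; [|exact: integZ..].
by apply: eq_Rintegral => x _; ring.
Qed.

Definition spectrum a xi : R := cos_transform a xi ^+ 2 + sin_transform a xi ^+ 2.

Lemma spectrum_ge0 a xi : 0 <= spectrum a xi.
Proof. by rewrite addr_ge0 ?sqr_ge0. Qed.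

Definition abs_sum (y : 'rV[R]_n) : R := \sum_(i < n) `|y ord0 i|.

Lemma abs_sum_ge0 (y : 'rV[R]_n) : 0 <= abs_sum y.
Proof. exact: sumr_ge0. Qed.

Lemma measurable_abs_sum : measurable_fun setT abs_sum.
Proof.
apply: measurable_sum => i.
exact: (measurableT_comp (@normr_measurable R setT) (measurable_coord i)).
Qed.

Lemma damping_expR (y : 'rV[R]_n) : damping y = expR (- abs_sum y).
Proof.
rewrite /damping /abs_sum -sumrN expR_sum.
by apply: eq_bigr => i _.
Qed.

(* Damping by exp(-|y|_1) makes the integrand integrable on the product, so that
   Fubini gives measurability; the damping is then divided out. *)
Lemma measurable_bounded_transform (c : 'rV[R]_n * 'rV[R]_n -> R) a :
  measurable_fun setT c -> (forall p, `|c p| <= 1) -> integ mu a ->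
  measurable_fun setT (fun y => \int[mu]_x (c (x, y) * a x)).
Proof.
move=> mc c1 ia; have ma := integ_measurable ia.
pose G (p : 'rV[R]_n * 'rV[R]_n) := c p * (a p.1).
have mG : measurable_fun setT G.
  apply: measurable_funM; first exact: mc.
  exact: measurableT_comp ma measurable_fst.
pose E (y : 'rV[R]_n) : R := damping y.
have mE := @measurable_damping R n.
have iG : integ (mu \x mu)%E (fun p => G p * E p.2).
  apply: (integ_dominated_prod (p := fun x => `|a x|) (q := E)).
  - by apply: measurable_funM => //; exact: measurableT_comp mE measurable_snd.
  - exact: integ_norm.
  - exact: integ_damping.
  - move=> x y; rewrite normrM (ger0_norm (damping_ge0 y)) ler_wpM2r ?damping_ge0//.
    by rewrite normrM ler_piMl.
have [/integ_measurable i1 _] := integ_fubini2 iG.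
have ica y : integ mu (fun x => c (x, y) * a x).
  apply: (integ_bounded (k := 1) _ ia) => //.
  exact: measurableT_comp mc (pair2_measurable y).
have -> : (fun y => \int[mu]_x (c (x, y) * a x)) =
    (fun y => (\int[mu]_x (G (x, y) * E y)) * expR (abs_sum y)).
  apply/funext => y.
  have -> : \int[mu]_x (G (x, y) * E y) = E y * \int[mu]_x (c (x, y) * a x).
    by rewrite -RintZ//; apply: eq_Rintegral => x _; rewrite mulrC.
  by rewrite mulrAC /E damping_expR -expRD addNr expR0 mul1r.
apply: measurable_funM; first exact: i1.
exact: (measurableT_comp (@measurable_expR R) measurable_abs_sum).
Qed.

Lemma measurable_cos_transform a : integ mu a ->
  measurable_fun setT (cos_transform a).
Proof.
apply: (measurable_bounded_transform (c := fun p => cos (dot p.1 p.2))).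
  exact: measurable_cos_dot.
by move=> p; exact: normr_cos_le1.
Qed.

Lemma measurable_sin_transform a : integ mu a ->
  measurable_fun setT (sin_transform a).
Proof.
apply: (measurable_bounded_transform (c := fun p => sin (dot p.1 p.2))).
  exact: measurable_sin_dot.
by move=> p; exact: normr_sin_le1.
Qed.

Lemma measurable_spectrum a : integ mu a -> measurable_fun setT (spectrum a).
Proof.
move=> ia; apply: measurable_funD; apply: measurable_funX.
  exact: measurable_cos_transform.
exact: measurable_sin_transform.
Qed.

(* After w = r z, the right-hand side averages the autocorrelation against the
   approximate identity r^n kernel(r z). *)
Lemma damped_spectrum a (r : R) : 0 < r -> integ mu a -> sqint mu a ->
  integ mu (fun xi => spectrum a xi * damping (r^-1 *: xi)) /\
  \int[mu]_xi (spectrum a xi * damping (r^-1 *: xi)) =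
  \int[mu]_w (autocorrelation a (r^-1 *: w) * kernel w).
Proof.
move=> r0 ia sa; have rn0 : r != 0 by rewrite gt_eqF.
have rV0 : r^-1 != 0 by rewrite invr_eq0.
have iA := integ_autocorrelation ia; have mA := integ_measurable iA.
have scaleE (c : R) x : affine_rV c 0 x = c *: x by rewrite /affine_rV addr0.
have iD : integ mu (fun xi => damping (r^-1 *: xi)).
  have := integ_affine 0 rV0 (@integ_damping R n).
  by apply: eq_integ => xi; rewrite scaleE.
have mD := integ_measurable iD.
pose H (p : 'rV[R]_n * 'rV[R]_n) :=
  (cos (dot p.2 p.1) * autocorrelation a p.2) * damping (r^-1 *: p.1).
have iH : integ (mu \x mu)%E H.
  apply: (integ_dominated_prod (p := fun xi => damping (r^-1 *: xi))
    (q := fun z => `|autocorrelation a z|)) => //.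
  - apply: measurable_funM.
      apply: measurable_funM; first exact: measurable_cos_dot.
      exact: measurableT_comp mA measurable_snd.
    exact: measurableT_comp mD measurable_fst.
  - exact: integ_norm.
  - move=> xi z; rewrite normrM (ger0_norm (damping_ge0 _)) mulrC.
    by rewrite ler_wpM2l ?damping_ge0// normrM ler_piMl// normr_cos_le1.
have HE xi : \int[mu]_z H (xi, z) = spectrum a xi * damping (r^-1 *: xi).
  rewrite /spectrum power_spectrum// mulrC -RintZ; last exact: integ_cos_dot.
  by apply: eq_Rintegral => z _; rewrite mulrC.
have [iS _] := integ_fubini1 iH.
split; first by apply: eq_integ iS => xi; rewrite HE.
under eq_Rintegral do rewrite -HE.
rewrite Rint_fubini//.
(* For fixed [z] the substitution [y = xi / r] produces the transform of [damping] at [r z]. *)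
have DE z : \int[mu]_xi H (xi, z) =
    r ^+ n * (autocorrelation a z * kernel (r *: z)).
  have [i1 _ _ I1] := damping_fourier (r *: z).
  have i2' := integ_affine 0 rV0 i1.
  have E xi : cos (dot (r *: z) (affine_rV r^-1 0 xi)) * damping (affine_rV r^-1 0 xi) =
      cos (dot z xi) * damping (r^-1 *: xi).
    by rewrite scaleE dotZl dotZr mulrA mulfV// mul1r.
  have i2 := eq_integ E i2'.
  rewrite -I1 (Rint_affine 0 rV0 i1) (eq_Rintegral _ (fun xi _ => E xi)).
  rewrite normfV (gtr0_norm r0) exprVn; set J := (X in _ = _ * (_ * (_ * X))).
  have -> : r ^+ n * (autocorrelation a z * ((r ^+ n)^-1 * J)) = autocorrelation a z * J.
    by field; rewrite expf_neq0.
  rewrite -RintZ//.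
  by apply: eq_Rintegral => xi _; rewrite /H/=; ring.
under eq_Rintegral do rewrite DE.
have ik : integ mu (fun w => autocorrelation a (r^-1 *: w) * kernel w).
  apply: (integ_bounded (k := ip mu a a) _ (@kernel_integral R n).1) => [|x].
    have := measurable_comp_affine r^-1 0 mA.
    by congr (measurable_fun _ _); apply/funext => x; rewrite scaleE.
  exact: autocorrelation_le.
have i3' := integ_affine 0 rn0 ik.
have E w : autocorrelation a (r^-1 *: affine_rV r 0 w) * kernel (affine_rV r 0 w) =
    autocorrelation a w * kernel (r *: w).
  by rewrite scaleE scalerA mulVf// scale1r.
have i3 := eq_integ E i3'.
rewrite (Rint_affine 0 rn0 ik) (eq_Rintegral _ (fun w _ => E w)).
by rewrite (gtr0_norm r0) RintZ.
Qed.

(** The integrals of [damped_spectrum] at [r = k + 1] have two limits. On the autocorrelation side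
    convergence is dominated by [ip mu a a * kernel]; on the spectrum side it is monotone, which
    also yields the integrability of the spectrum, not known beforehand. *)
Lemma plancherel_real a : integ mu a -> sqint mu a ->
  integ mu (spectrum a) /\
  \int[mu]_xi spectrum a xi = (2 * pi) ^+ n * ip mu a a.
Proof.
move=> ia sa; have ms := measurable_spectrum ia.
have [ik Ik] := @kernel_integral R n.
have mA := integ_measurable (integ_autocorrelation ia).
have scaleE (c : R) x : affine_rV c 0 x = c *: x by rewrite /affine_rV addr0.
have [_ lim1] : integ mu (fun w => ip mu a a * kernel w) /\
   (\int[mu]_w (autocorrelation a (k.+1%:R^-1 *: w) * kernel w) @[k --> \oo] -->
    \int[mu]_w (ip mu a a * kernel w)).
  apply: (dominated_Rint (g := fun w => ip mu a a * kernel w)).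
  - move=> k; apply: measurable_funM; last exact: measurable_kernel.
    have := measurable_comp_affine k.+1%:R^-1 0 mA.
    by congr (measurable_fun _ _); apply/funext => x; rewrite scaleE.
  - by apply: measurable_funM => //; exact: measurable_kernel.
  - by move=> w; apply: cvgMr_tmp; exact: autocorrelation_cvg0.
  - exact: integZ.
  - move=> k w; rewrite normrM (ger0_norm (kernel_ge0 w)).
    by rewrite ler_wpM2r ?kernel_ge0// autocorrelation_le.
rewrite RintZ// Ik mulrC in lim1.
have ds k := @damped_spectrum a k.+1%:R (ltr0Sn R k) ia sa.
have lim2 : (\int[mu]_xi (spectrum a xi * damping (k.+1%:R^-1 *: xi))%:E @[k --> \oo]
    --> ((2 * pi) ^+ n * ip mu a a)%:E)%E.
  rewrite (_ : (fun k : nat => _) = (fun k : nat => (\int[mu]_w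
      (autocorrelation a (k.+1%:R^-1 *: w) * kernel w))%:E)); last first.
    by apply/funext => k; rewrite -(ds k).2 integ_EFin//; exact: (ds k).1.
  by apply: cvg_EFin => //; exact: nearW.
have dE k xi : damping (k.+1%:R^-1 *: xi) = expR (- (k.+1%:R^-1 * abs_sum xi)).
  rewrite damping_expR /abs_sum mulr_sumr; congr (expR (- _)).
  by apply: eq_bigr => i _; rewrite mxE normrM ger0_norm.
have lim3 : (\int[mu]_xi (spectrum a xi * damping (k.+1%:R^-1 *: xi))%:E @[k --> \oo]
    --> \int[mu]_xi (spectrum a xi)%:E)%E.
  rewrite (_ : (\int[mu]_xi (spectrum a xi)%:E)%E = (\int[mu]_xi limn (fun k =>
      (spectrum a xi * damping (k.+1%:R^-1 *: xi))%:E))%E); last first.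
    apply: eq_integral => xi _; apply/esym/cvg_lim => //; apply: cvg_EFin.
      exact: nearW.
    rewrite -[X in _ --> X]mulr1; apply: cvgMl_tmp.
    have H : - (k.+1%:R^-1 * abs_sum xi) @[k --> \oo] --> - (0 * abs_sum xi).
      by apply: cvgN; apply: cvgMr_tmp; exact: cvg_harmonic.
    have : expR (- (k.+1%:R^-1 * abs_sum xi)) @[k --> \oo] --> expR (- (0 * abs_sum xi)).
      by apply: continuous_cvg H; exact: continuous_expR.
    rewrite mul0r oppr0 expR0; apply: cvg_trans.
    by under eq_fun do rewrite dE.
  apply: cvg_monotone_convergence => //.
  - by move=> k; apply/measurable_EFinP; exact: integ_measurable (ds k).1.
  - by move=> k xi _; rewrite lee_fin mulr_ge0 ?spectrum_ge0 ?damping_ge0.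
  - move=> xi _ j k jk; rewrite lee_fin ler_wpM2l ?spectrum_ge0// !dE ler_expR lerN2.
    by rewrite ler_wpM2r ?abs_sum_ge0// lef_pV2 ?posrE// ler_nat.
have E : (\int[mu]_xi (spectrum a xi)%:E)%E = ((2 * pi) ^+ n * ip mu a a)%:E.
  exact: cvg_unique lim3 lim2.
split; last by rewrite /Rintegral E.
by apply: ge0_integP => //; [exact: spectrum_ge0|rewrite E ltry].
Qed.

End plancherel_real.

(** * The Fourier transform on complex L^2 *)

Section complex_real_parts.
Context {R : rcfType}.
Implicit Types z w : R[i].

Lemma ReD z w : complex.Re (z + w) = complex.Re z + complex.Re w.
Proof. by case: z; case: w. Qed.

Lemma ImD z w : complex.Im (z + w) = complex.Im z + complex.Im w.
Proof. by case: z; case: w. Qed.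

Lemma ReN z : complex.Re (- z) = - complex.Re z.
Proof. by case: z. Qed.

Lemma ImN z : complex.Im (- z) = - complex.Im z.
Proof. by case: z. Qed.

Lemma ReZ (a : R) z : complex.Re (a%:C * z) = a * complex.Re z.
Proof. by case: z => x y; rewrite /= mul0r subr0. Qed.

Lemma ImZ (a : R) z : complex.Im (a%:C * z) = a * complex.Im z.
Proof. by case: z => x y; rewrite /= mul0r addr0. Qed.

End complex_real_parts.

(** * Complex L^2 through real and imaginary parts *)

Section complex_L2.
Context {R : realType} {n : nat}.
Local Notation mu := (@lebesgue_rV R n).
Implicit Types f g h : 'rV[R]_n -> R[i].

Definition re f x : R := complex.Re (f x).
Definition im f x : R := complex.Im (f x).

Definition sqintc f := sqint mu (re f) /\ sqint mu (im f).
Definition integc f := integ mu (re f) /\ integ mu (im f).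
(** The real part of the inner product of complex L^2. *)
Definition ipc f g : R := ip mu (re f) (re g) + ip mu (im f) (im g).

Lemma reD f g : re (fun x => f x + g x) = fun x => re f x + re g x.
Proof. by apply/funext => x; exact: ReD. Qed.

Lemma imD f g : im (fun x => f x + g x) = fun x => im f x + im g x.
Proof. by apply/funext => x; exact: ImD. Qed.

Lemma reB f g : re (fun x => f x - g x) = fun x => re f x - re g x.
Proof. by apply/funext => x; rewrite /re ReD ReN. Qed.

Lemma imB f g : im (fun x => f x - g x) = fun x => im f x - im g x.
Proof. by apply/funext => x; rewrite /im ImD ImN. Qed.

Lemma reZ (a : R) f : re (fun x => a%:C * f x) = fun x => a * re f x.
Proof. by apply/funext => x; rewrite /re ReZ. Qed.

Lemma imZ (a : R) f : im (fun x => a%:C * f x) = fun x => a * im f x.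
Proof. by apply/funext => x; rewrite /im ImZ. Qed.

Lemma sqintcD f g : sqintc f -> sqintc g -> sqintc (fun x => f x + g x).
Proof. by move=> [? ?] [? ?]; rewrite /sqintc reD imD; split; exact: sqintD. Qed.

Lemma sqintcB f g : sqintc f -> sqintc g -> sqintc (fun x => f x - g x).
Proof. by move=> [? ?] [? ?]; rewrite /sqintc reB imB; split; exact: sqintB. Qed.

Lemma integcD f g : integc f -> integc g -> integc (fun x => f x + g x).
Proof. by move=> [? ?] [? ?]; rewrite /integc reD imD; split; exact: integD. Qed.

Lemma sqintcZ a f : sqintc f -> sqintc (fun x => a%:C * f x).
Proof. by move=> [? ?]; rewrite /sqintc reZ imZ; split; exact: sqintZ. Qed.

Lemma ipcC f g : ipc f g = ipc g f.
Proof. by congr (_ + _); exact: ipC. Qed.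

Lemma ipc_ge0 f : 0 <= ipc f f.
Proof. by rewrite addr_ge0 ?ip_ge0. Qed.

Lemma sq_ipcD f g : sqintc f -> sqintc g ->
  ipc (fun x => f x + g x) (fun x => f x + g x) = ipc f f + 2 * ipc f g + ipc g g.
Proof.
by move=> [? ?] [? ?]; rewrite /ipc reD imD !sq_ipD//; ring.
Qed.

Lemma ipc_sqD_le f g : sqintc f -> sqintc g ->
  ipc (fun x => f x + g x) (fun x => f x + g x) <= 2 * ipc f f + 2 * ipc g g.
Proof.
move=> [? ?] [? ?]; rewrite /ipc reD imD.
by rewrite !mulrDr addrACA lerD//; exact: ip_sqD_le.
Qed.

(** Expansion of [|f + (h - f)|^2], the cross term being split with weight [s]. It carries equality
    of norms over to limits. *)
Lemma ipc_perturb f h (s e : R) : 0 < s -> sqintc f -> sqintc h ->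
  ipc (fun x => h x - f x) (fun x => h x - f x) <= e ->
  `|ipc h h - ipc f f| <= s * ipc f f + (s^-1 + 1) * e.
Proof.
move=> s0 sf sh he; have sd := sqintcB sh sf; set d := fun x => h x - f x in sd he.
have hE : h = (fun x => f x + d x) by apply/funext => x; rewrite addrC subrK.
have -> : ipc h h = ipc f f + 2 * ipc f d + ipc d d by rewrite {1 2}hE sq_ipcD.
have [sd1 sd2] := sd; have [sf1 sf2] := sf.
have d0 := ipc_ge0 d.
have s'0 : 0 <= s^-1 by rewrite invr_ge0 ltW.
have H : 2 * ipc f d <= s * ipc f f + s^-1 * ipc d d.
  have := weighted_cauchy_schwarz s0 sf1 sd1.
  have := weighted_cauchy_schwarz s0 sf2 sd2.
  by rewrite /ipc !mulrDr; lra.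
have H' : - (2 * ipc f d) <= s * ipc f f + s^-1 * ipc d d.
  have := weighted_cauchy_schwarz s0 (sqintZ (-1) sf1) sd1.
  have := weighted_cauchy_schwarz s0 (sqintZ (-1) sf2) sd2.
  rewrite !(ipZl, ipZr)//; [|exact: sqintZ..].
  by rewrite /ipc !mulrDr; lra.
have : s^-1 * ipc d d <= s^-1 * e by rewrite ler_wpM2l.
by rewrite ler_norml => ?; apply/andP; split; lra.
Qed.

Lemma cmodulus_sqr (z : R[i]) :
  cmodulus z ^+ 2 = complex.Re z ^+ 2 + complex.Im z ^+ 2.
Proof. by case: z => x y; rewrite /cmodulus/= sqr_sqrtr// addr_ge0 ?sqr_ge0. Qed.

Lemma cmodulus_ge0 (z : R[i]) : 0 <= cmodulus z.
Proof. by case: z => x y; exact: sqrtr_ge0. Qed.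

Lemma Re_le_cmodulus (z : R[i]) : `|complex.Re z| <= cmodulus z.
Proof.
rewrite -(ler_pXn2r (n := 2))// ?nnegrE ?cmodulus_ge0//.
by rewrite real_normK ?num_real// cmodulus_sqr lerDl sqr_ge0.
Qed.

Lemma Im_le_cmodulus (z : R[i]) : `|complex.Im z| <= cmodulus z.
Proof.
rewrite -(ler_pXn2r (n := 2))// ?nnegrE ?cmodulus_ge0//.
by rewrite real_normK ?num_real// cmodulus_sqr lerDr sqr_ge0.
Qed.

Lemma cLnorm2E f : (cLnorm 2%:E f `^ 2 =
  \int[mu]_x (re f x ^+ 2 + im f x ^+ 2)%:E)%E.
Proof.
rewrite /cLnorm poweR_Lnorm ?pnatr_eq0//; apply: eq_integral => x _.
rewrite /= ger0_norm ?cmodulus_ge0// powR_mulrn ?cmodulus_ge0//.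
by rewrite cmodulus_sqr.
Qed.

Lemma cLnorm2_lty f : cmeasurable f -> (cLnorm 2%:E f < +oo)%E -> sqintc f.
Proof.
move=> [mf1 mf2] fy.
have i12 : integ mu (fun x => re f x ^+ 2 + im f x ^+ 2).
  apply: ge0_integP.
  - by apply: measurable_funD; apply: measurable_funX.
  - by move=> x; rewrite addr_ge0 ?sqr_ge0.
  - by rewrite -cLnorm2E poweR_lty.
split; split => //; apply: (integ_le _ i12); try exact: measurable_funX;
  by move=> x; rewrite ger0_norm ?sqr_ge0// ?lerDl ?lerDr sqr_ge0.
Qed.

Lemma cLp2_sqintc f : cLp 2%:E f -> sqintc f.
Proof. by move=> [mf fy]; exact: cLnorm2_lty. Qed.

Lemma cLnorm2_lt f (e : R) : cmeasurable f -> (cLnorm 2%:E f < e%:E)%E ->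
  sqintc f /\ ipc f f < e ^+ 2.
Proof.
move=> mf fe; have sf : sqintc f by apply: cLnorm2_lty => //; exact: lt_trans (ltry e).
split => //; have [[m1 i1] [m2 i2]] := sf.
have e0 : 0 < e by rewrite -lte_fin; apply: le_lt_trans fe; exact: Lnorm_ge0.
have := cLnorm2E f; rewrite integ_EFin; last exact: integD.
rewrite RintD// => H.
have nf0 : (0 <= cLnorm 2%:E f)%E by exact: Lnorm_ge0.
have nfin : cLnorm 2%:E f \is a fin_num by rewrite ge0_fin_numE// (lt_trans fe) ?ltry.
have r0 : 0 <= fine (cLnorm 2%:E f) by exact: fine_ge0.
rewrite /ipc; suff -> : ip mu (re f) (re f) + ip mu (im f) (im f) =
    fine (cLnorm 2%:E f) ^+ 2.
  by rewrite ltrXn2r// ?nnegrE ?ltW// -lte_fin fineK.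
apply: EFin_inj; rewrite -powR_mulrn// -poweR_EFin fineK//.
Qed.

Lemma measurable_cmodulus f : cmeasurable f ->
  measurable_fun setT (fun x => cmodulus (f x)).
Proof.
move=> [mf1 mf2].
have -> : (fun x => cmodulus (f x)) = Num.sqrt \o (fun x => re f x ^+ 2 + im f x ^+ 2).
  by apply/funext => x; rewrite /= -cmodulus_sqr sqrtr_sqr ger0_norm ?cmodulus_ge0.
apply: (measurableT_comp (continuous_measurable_fun (@sqrt_continuous R))).
by apply: measurable_funD; apply: measurable_funX.
Qed.

Lemma cLp1_integc f : cLp 1%:E f -> integc f.
Proof.
move=> [mf]; rewrite /finite_norm Lnorm1 => fy.
have mm := measurable_cmodulus mf.
have im' : integ mu (fun x => cmodulus (f x)).
  by apply/integrableP; split => //; exact/measurable_EFinP.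
by case: mf => mf1 mf2; split; apply: (integ_le _ im') => // x;
  [exact: Re_le_cmodulus|exact: Im_le_cmodulus].
Qed.

End complex_L2.

(** * Plancherel, Parseval and dilations *)

Section fourier.
Context {R : realType} {n : nat}.
Local Notation mu := (@lebesgue_rV R n).
Implicit Types f g h : 'rV[R]_n -> R[i].
Local Notation F := (@fourier_integral R n).
Local Notation C := (@cos_transform R n).
Local Notation S := (@sin_transform R n).
Let c0 : R := Num.sqrt (2 * pi) ^- n.

Let c0_sqr : c0 ^+ 2 * (2 * pi) ^+ n = 1.
Proof.
have p : 0 < 2 * pi :> R by rewrite mulr_gt0// pi_gt0.
rewrite /c0 -exprVn -exprM mulnC exprM -exprMn exprVn sqr_sqrtr ?ltW//.
by rewrite mulVf ?expr1n// gt_eqF.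
Qed.

Lemma re_fourier f xi : integc f ->
  re (F f) xi = c0 * (C (re f) xi + S (im f) xi).
Proof.
move=> [i1 i2]; rewrite /re /fourier_integral ReZ; congr (_ * _).
rewrite /cintegral /= -RintD; [|exact: integ_cos_dot|exact: integ_sin_dot].
apply: eq_Rintegral => x _; rewrite /re /im /expi cosN sinN.
by case: (f x) => a b /=; ring.
Qed.

Lemma im_fourier f xi : integc f ->
  im (F f) xi = c0 * (C (im f) xi - S (re f) xi).
Proof.
move=> [i1 i2]; rewrite /im /fourier_integral ImZ; congr (_ * _).
rewrite /cintegral /= -RintB; [|exact: integ_cos_dot|exact: integ_sin_dot].
apply: eq_Rintegral => x _; rewrite /re /im /expi cosN sinN.
by case: (f x) => a b /=; ring.
Qed.

Lemma cos_transformN a xi : C a (- xi) = C a xi.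
Proof. by apply: eq_Rintegral => x _; rewrite dotNr cosN. Qed.

Lemma sin_transformN a xi : integ mu a -> S a (- xi) = - S a xi.
Proof.
move=> ia; rewrite -mulN1r -RintZ; last exact: integ_sin_dot.
by apply: eq_Rintegral => x _; rewrite dotNr sinN; ring.
Qed.

Lemma sqint_transforms a : integ mu a -> sqint mu a ->
  sqint mu (C a) /\ sqint mu (S a).
Proof.
move=> ia sa; have [i1 _] := plancherel_real ia sa.
have mC := measurable_cos_transform ia; have mS := measurable_sin_transform ia.
split; split => //; apply: (integ_le _ i1); try exact: measurable_funX;
  by move=> x; rewrite ger0_norm ?sqr_ge0// /spectrum ?lerDl ?lerDr sqr_ge0.
Qed.

Lemma ip_transforms a : integ mu a -> sqint mu a ->
  ip mu (C a) (C a) + ip mu (S a) (S a) = (2 * pi) ^+ n * ip mu a a.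
Proof.
move=> ia sa; have [sC sS] := sqint_transforms ia sa.
rewrite -(plancherel_real ia sa).2 /ip -RintD; [|exact: sqintM..].
by apply: eq_Rintegral => x _; rewrite -!expr2.
Qed.

(* For f = a + ib with a, b real, the cross terms of |F f|^2 = |F a + i F b|^2
   are odd, hence integrate to 0. *)
Lemma plancherel f : integc f -> sqintc f ->
  sqintc (F f) /\ ipc (F f) (F f) = ipc f f.
Proof.
move=> ic [s1 s2]; have [i1 i2] := ic.
have [c1 t1] := sqint_transforms i1 s1; have [c2 t2] := sqint_transforms i2 s2.
have reE : re (F f) = fun xi => c0 * (C (re f) xi + S (im f) xi).
  by apply/funext => xi; exact: re_fourier.
have imE : im (F f) = fun xi => c0 * (C (im f) xi - S (re f) xi).
  by apply/funext => xi; exact: im_fourier.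
have sp := sqintD c1 t2; have sm := sqintB c2 t1.
split; first by rewrite /sqintc reE imE; split; exact: sqintZ.
rewrite /ipc reE imE !(ipZl, ipZr)//; do ?exact: sqintZ.
rewrite sq_ipD// sq_ipB//.
have E1 := ip_transforms i1 s1; have E2 := ip_transforms i2 s2.
have alg (c x u y z v w : R) : u - v = 0 ->
    c * (c * (x + 2 * u + y)) + c * (c * (z - 2 * v + w)) =
    c ^+ 2 * ((x + w) + (z + y)).
  by move=> /subr0_eq ->; ring.
have odd : ip mu (C (re f)) (S (im f)) - ip mu (C (im f)) (S (re f)) = 0.
  rewrite /ip -RintB; [|exact: sqintM..]; apply: Rint_odd.
    by apply: integB; exact: sqintM.
  by move=> xi; rewrite !cos_transformN !sin_transformN//; ring.
transitivity (c0 ^+ 2 * ((2 * pi) ^+ n * ip mu (re f) (re f) +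
    (2 * pi) ^+ n * ip mu (im f) (im f))).
  by rewrite -E1 -E2; exact: alg.
by rewrite -mulrDr mulrA c0_sqr mul1r.
Qed.

Lemma fourierD f g : integc f -> integc g ->
  F (fun x => f x + g x) = fun xi => F f xi + F g xi.
Proof.
move=> f1 g1; have fg := integcD f1 g1; apply/funext => xi.
have [i1 i2] := f1; have [j1 j2] := g1.
have CD a b : integ mu a -> integ mu b -> C (fun x => a x + b x) xi = C a xi + C b xi.
  move=> ia ib; rewrite -RintD; [|exact: integ_cos_dot..].
  by apply: eq_Rintegral => x _; rewrite mulrDr.
have SD a b : integ mu a -> integ mu b -> S (fun x => a x + b x) xi = S a xi + S b xi.
  move=> ia ib; rewrite -RintD; [|exact: integ_sin_dot..].
  by apply: eq_Rintegral => x _; rewrite mulrDr.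
apply/eqP; rewrite eq_complex -/(re _ xi) -/(im _ xi) ReD ImD.
rewrite -/(re (F f) xi) -/(im (F f) xi) -/(re (F g) xi) -/(im (F g) xi).
rewrite !re_fourier// !im_fourier// reD imD !CD// !SD//.
by apply/andP; split; apply/eqP; ring.
Qed.

(* All that is used of [fourier_L2] once Plancherel's theorem is known; unlike
   [fourier_L2] it is directly seen to be stable under sums and dilations. *)
Definition fourier_pair f g := [/\ sqintc f, sqintc g & forall e, 0 < e ->
  exists h, [/\ integc h, sqintc h,
    ipc (fun x => h x - f x) (fun x => h x - f x) < e &
    ipc (fun x => F h x - g x) (fun x => F h x - g x) < e]].

Lemma fourier_L2_pair f g : fourier_L2 f g -> fourier_pair f g.
Proof.
move=> [/cLp2_sqintc sf /cLp2_sqintc sg [f_ [Lf cf cg]]]; split => // e e0.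
have ee : 0 < Num.sqrt e by rewrite sqrtr_gt0.
have ae_lt (u : nat -> \bar R) : (u k @[k --> \oo] --> 0)%E ->
    \forall k \near \oo, (u k < (Num.sqrt e)%:E)%E.
  move=> /fine_cvgP[ufin /cvgrPdist_lt /(_ _ ee) u0]; near=> k.
  have uk : u k \is a fin_num by near: k; exact: ufin.
  rewrite -(fineK uk) lte_fin; apply: le_lt_trans (ler_norm _) _.
  by rewrite -normrN -sub0r; near: k; exact: u0.
have [k [k1 k2]] : exists k, (cLnorm 2%:E (f_ k \- f)%R < (Num.sqrt e)%:E)%E /\
    (cLnorm 2%:E (F (f_ k) \- g)%R < (Num.sqrt e)%:E)%E.
  have H1 := ae_lt _ cf; have H2 := ae_lt _ cg.
  by near \oo => k; exists k; split; near: k; [exact: H1|exact: H2].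
have [L1 L2] := Lf k; have ih := cLp1_integc L1; have sh := cLp2_sqintc L2.
exists (f_ k); split => //.
  have [|_] := @cLnorm2_lt _ _ _ (Num.sqrt e) _ k1.
    have [[? _] [? _]] := sqintcB sh sf; split => //.
  by rewrite sqr_sqrtr ?ltW.
have [sF _] := plancherel ih sh.
have [|_] := @cLnorm2_lt _ _ _ (Num.sqrt e) _ k2.
  have [[? _] [? _]] := sqintcB sF sg; split => //.
by rewrite sqr_sqrtr ?ltW.
Unshelve. all: by end_near. Qed.

(** Both norms are close to that of one approximant [h], whose norm its Fourier integral
    preserves. *)
Lemma fourier_pair_norm f g : fourier_pair f g -> ipc f f = ipc g g.
Proof.
move=> [sf sg H]; apply/eqP; rewrite -subr_eq0 -normr_le0; apply/ler_addgt0Pl => e e0.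
rewrite addr0; pose A := ipc f f + ipc g g + 1.
have A0 : 0 < A by rewrite ltr_wpDl// addr_ge0 ?ipc_ge0.
(* The terms [s |f|^2 + s |g|^2] contribute at most [s A = e / 2], and each of the two approximation
   errors [e / 4]. *)
pose s := e / (2 * A); have s0 : 0 < s by rewrite divr_gt0// mulr_gt0.
have s1 : 0 < 2 * (s^-1 + 1) by rewrite mulr_gt0// ltr_wpDl// invr_ge0 ltW.
have [|h [ih sh hf hg]] := H (e / (2 * (2 * (s^-1 + 1)))).
  by rewrite divr_gt0// mulr_gt0.
have [sF EF] := plancherel ih sh.
have := ipc_perturb s0 sf sh (ltW hf); have := ipc_perturb s0 sg sF (ltW hg).
rewrite EF; set B := (s^-1 + 1) * _.
have alg (v : R) : v != 0 -> v * (e / (2 * (2 * v))) = e / 4 by move=> ?; field.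
have -> : B = e / 4 by apply: alg; rewrite gt_eqF// ltr_wpDl// invr_ge0 ltW.
have sA : s * A = e / 2 by rewrite /s; field; rewrite gt_eqF.
have : s * ipc f f + s * ipc g g <= s * A.
  by rewrite -mulrDr ler_wpM2l// ?ltW// /A; lra.
rewrite !ler_norml => ? /andP[? ?] /andP[? ?]; apply/andP; split; lra.
Qed.

Lemma fourier_pairD f g f' g' : fourier_pair f g -> fourier_pair f' g' ->
  fourier_pair (fun x => f x + f' x) (fun x => g x + g' x).
Proof.
move=> [sf sg H] [sf' sg' H']; split; [exact: sqintcD..|] => e e0.
have e4 : 0 < e / 4 by rewrite divr_gt0.
have [h [ih sh hf hg]] := H _ e4; have [h' [ih' sh' hf' hg']] := H' _ e4.
have [sF _] := plancherel ih sh; have [sF' _] := plancherel ih' sh'.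
exists (fun x => h x + h' x); split.
- exact: integcD.
- exact: sqintcD.
- have := ipc_sqD_le (sqintcB sh sf) (sqintcB sh' sf').
  have -> : (fun x => h x - f x + (h' x - f' x)) = (fun x => h x + h' x - (f x + f' x)).
    by apply/funext => x; rewrite addrACA opprD.
  lra.
- rewrite fourierD//; have := ipc_sqD_le (sqintcB sF sg) (sqintcB sF' sg').
  have -> : (fun x => F h x - g x + (F h' x - g' x)) =
      (fun x => F h x + F h' x - (g x + g' x)).
    by apply/funext => x; rewrite addrACA opprD.
  lra.
Qed.

(** Polarization: norms are preserved for both pairs and for their sum. As [ipc] is symmetric, the
    cross term is [2 ipc f f']. *)
Lemma parseval f g f' g' : fourier_pair f g -> fourier_pair f' g' ->
  ipc f f' = ipc g g'.
Proof.
move=> P P'; have := fourier_pair_norm (fourier_pairD P P').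
have [sf sg _] := P; have [sf' sg' _] := P'.
rewrite !sq_ipcD// (fourier_pair_norm P) (fourier_pair_norm P'); lra.
Qed.

Lemma sqintc_affine (a : R) f : a != 0 -> sqintc f ->
  sqintc (fun x => f (affine_rV a 0 x)).
Proof. move=> a0 [s1 s2].
by split; [exact: (sqint_affine 0 a0 s1)|exact: (sqint_affine 0 a0 s2)]. Qed.

Lemma ipc_affine (a : R) f : a != 0 -> sqintc f ->
  ipc f f = `|a| ^+ n * ipc (fun x => f (affine_rV a 0 x)) (fun x => f (affine_rV a 0 x)).
Proof.
by move=> a0 [s1 s2]; rewrite /ipc (ip_affine 0 a0 s1 s1) (ip_affine 0 a0 s2 s2) mulrDr.
Qed.

(** The substitution [y = a x], under which [x . xi = y . (xi / a)]. *)
Lemma fourier_dilation (a : R) f xi : 0 < a -> integc f ->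
  F (fun x => f (affine_rV a 0 x)) xi =
  ((a ^+ n)^-1)%:C * F f (affine_rV a^-1 0 xi).
Proof.
move=> a0 ic; have an0 : a != 0 by rewrite gt_eqF.
have [i1 i2] := ic.
have icd : integc (fun x => f (affine_rV a 0 x)).
  by split; [exact: (integ_affine 0 an0 i1)|exact: (integ_affine 0 an0 i2)].
have dE x : dot (affine_rV a 0 x) (affine_rV a^-1 0 xi) = dot x xi.
  by rewrite /affine_rV !addr0 dotZl dotZr mulrA mulfV// mul1r.
have an : a ^+ n != 0 by rewrite expf_neq0.
have CE (b : 'rV[R]_n -> R) : integ mu b -> C (fun x => b (affine_rV a 0 x)) xi =
    (a ^+ n)^-1 * C b (affine_rV a^-1 0 xi).
  move=> ib; rewrite /cos_transform.
  rewrite (Rint_affine 0 an0 (integ_cos_dot (affine_rV a^-1 0 xi) ib)).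
  rewrite (gtr0_norm a0) mulKf//.
  by apply: eq_Rintegral => x _; rewrite dE.
have SE (b : 'rV[R]_n -> R) : integ mu b -> S (fun x => b (affine_rV a 0 x)) xi =
    (a ^+ n)^-1 * S b (affine_rV a^-1 0 xi).
  move=> ib; rewrite /sin_transform.
  rewrite (Rint_affine 0 an0 (integ_sin_dot (affine_rV a^-1 0 xi) ib)).
  rewrite (gtr0_norm a0) mulKf//.
  by apply: eq_Rintegral => x _; rewrite dE.
apply/eqP; rewrite eq_complex; apply/andP; split; apply/eqP.
  apply: (etrans (re_fourier xi icd)); rewrite (CE _ i1) (SE _ i2) ReZ.
  by rewrite -/(re (F f) _) re_fourier//; ring.
apply: (etrans (im_fourier xi icd)); rewrite (CE _ i2) (SE _ i1) ImZ.
by rewrite -/(im (F f) _) im_fourier//; ring.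
Qed.

Lemma fourier_pair_dilation (a : R) f g : 0 < a -> fourier_pair f g ->
  fourier_pair (fun x => f (affine_rV a 0 x))
    (fun xi => ((a ^+ n)^-1)%:C * g (affine_rV a^-1 0 xi)).
Proof.
move=> a0 [sf sg H]; have an0 : a != 0 by rewrite gt_eqF.
have aV0 : a^-1 != 0 by rewrite invr_eq0.
have an : 0 < a ^+ n by rewrite exprn_gt0.
split; [exact: sqintc_affine|by apply: sqintcZ; exact: sqintc_affine|].
(* Dilation multiplies the squared error by [a^-n] on both sides: directly in position, and as
   [a^(-2n) a^n] in frequency. Hence the accuracy [a^n e]. *)
move=> e e0; have [h [ih sh hf hg]] := H _ (mulr_gt0 an e0).
have [sF _] := plancherel ih sh; have [i1 i2] := ih.
exists (fun x => h (affine_rV a 0 x)); split.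
- by split; [exact: (integ_affine 0 an0 i1)|exact: (integ_affine 0 an0 i2)].
- exact: sqintc_affine.
- move: hf; rewrite (ipc_affine an0 (sqintcB sh sf)) (gtr0_norm a0).
  by rewrite ltr_pM2l.
have sd := sqintcB sF sg.
have -> : (fun x => F (fun x => h (affine_rV a 0 x)) x -
      ((a ^+ n)^-1)%:C * g (affine_rV a^-1 0 x)) =
    (fun x => ((a ^+ n)^-1)%:C * (F h (affine_rV a^-1 0 x) - g (affine_rV a^-1 0 x))).
  by apply/funext => xi; rewrite fourier_dilation// mulrBr.
have [t1 t2] := sqintc_affine aV0 sd.
move: hg; rewrite (ipc_affine aV0 sd) normfV (gtr0_norm a0) exprVn.
rewrite /ipc reZ imZ !(ipZl, ipZr)//; do ?exact: sqintZ.
rewrite -!mulrDr => hg; rewrite -(ltr_pM2l an); apply: le_lt_trans hg.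
by rewrite mulVKf// gt_eqF.
Qed.

End fourier.

(** * Decay of the symbol and of the potential under dilations *)

Section one_variable.
Context {R : realType}.

Lemma MVT_from0 (p p' : R -> R) (t : R) :
  (forall s, is_derive s (1 : R) p (p' s)) -> 0 < t ->
  exists s, [/\ 0 < s, s < t & p t - p 0 = p' s * t].
Proof.
move=> dp t0; have [|s] := @MVT R p p' 0 t t0 (fun s _ => dp s).
  apply: continuous_subspaceT => s; apply: differentiable_continuous.
  by apply/derivable1_diffP; have [] := dp s.
by rewrite in_itv/= subr0 => /andP[s0 st] E; exists s.
Qed.

(** Gronwall's inequality: [e^(nu s) p(s)] has nonpositive derivative. No sign of [p] is assumed, so
    it serves for the symbol and for the potential. *)
Lemma exp_decay (p p' : R -> R) (nu t : R) :
  (forall s, is_derive s (1 : R) p (p' s)) -> (forall s, p' s <= - nu * p s) ->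
  0 <= t -> p t <= expR (- nu * t) * p 0.
Proof.
move=> dp p'le; rewrite le_eqVlt => /predU1P[<-|t0].
  by rewrite mulr0 expR0 mul1r.
have dG s : is_derive s (1 : R) (fun s => expR (nu * s) * p s)
    (expR (nu * s) * (p' s + nu * p s)).
  apply: is_derive_eq; rewrite /GRing.scale/=; ring.
have [s [_ _]] := MVT_from0 dG t0; rewrite mulr0 expR0 mul1r => E.
have : expR (nu * t) * p t <= p 0.
  rewrite -subr_le0 E pmulr_lle0// pmulr_rle0 ?expR_gt0//.
  by have := p'le s; lra.
move=> H; rewrite mulNr -(ler_pM2l (expR_gt0 (nu * t))) mulrA -expRD.
by rewrite subrr expR0 mul1r.
Qed.

End one_variable.

(** * The kinetic symbol along dilations *)

Section dilation_of_symbol.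
Context {R : realType} (Psi : R -> R) (mu c2 d2 : R).
Hypothesis Psi_C1 : C1_pos Psi.
Hypothesis Psi_ge0 : forall u, 0 <= u -> 0 <= Psi u.
Hypothesis Psi0 : Psi 0 = 0.
Hypotheses (c2_ge0 : 0 <= c2) (d2_ge0 : 0 <= d2) (mu_gt0 : 0 < mu).
Hypothesis dPsi_le : forall u, 0 <= u -> u * derive1 Psi u <= c2 * Psi u + d2.
Hypothesis dPsi_ge : forall u, 0 <= u -> mu * Psi u <= 2 * u * derive1 Psi u.

(** Along [v = e^(-2s) u] the derivative is [-2 v Psi'(v)], so the conditions on [u Psi'(u)] become
    differential inequalities in [s]. The exponent 2 reflects that [u] is quadratic in the
    frequency. *)
Let derive_dilated (u s : R) : 0 < u ->
  is_derive s (1 : R) (fun s => Psi (expR (- 2 * s) * u))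
    (- 2 * ((expR (- 2 * s) * u) * derive1 Psi (expR (- 2 * s) * u))).
Proof.
move=> u0; set v := expR (- 2 * s) * u; have v0 : 0 < v by rewrite mulr_gt0 ?expR_gt0.
have [dv _] := Psi_C1 v0.
have d1 : is_derive (expR (- 2 * s) * u) (1 : R) Psi (derive1 Psi v).
  by rewrite derive1E; exact/derivableP.
have d2' : is_derive s (1 : R) (fun s => expR (- 2 * s) * u) (- 2 * v).
  by apply: is_derive_eq; rewrite /GRing.scale/= /v; ring.
have -> : - 2 * (v * derive1 Psi v) = derive1 Psi v * (- 2 * v) by ring.
exact: (@is_derive1_comp R Psi (fun s => expR (- 2 * s) * u) s _ _ d1 d2').
Qed.

(** By [dPsi_ge], [p(s) = Psi(e^(-2s) u)] satisfies [p' <= - mu p]. The point [u = 0], where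
    differentiability is not assumed, is settled by [Psi 0 = 0]. *)
Lemma symbol_dilation_decay (t u : R) : 0 <= t -> 0 <= u ->
  Psi (expR (- 2 * t) * u) <= expR (- mu * t) * Psi u.
Proof.
move=> t0; rewrite le_eqVlt => /predU1P[<-|u0]; first by rewrite mulr0 Psi0 mulr0.
have := @exp_decay _ _ _ mu t (fun s => derive_dilated s u0).
rewrite mulr0 expR0 mul1r; apply => // s.
have v0 : 0 <= expR (- 2 * s) * u by rewrite ltW// mulr_gt0 ?expR_gt0.
by have := dPsi_ge v0; lra.
Qed.

(** The mean value theorem gives [2 t v Psi'(v)] at an intermediate [v], and [dPsi_le] bounds it by
    [2 t (c2 Psi(v) + d2)]. The decay just shown yields [Psi(v) <= Psi(u)]. *)
Lemma symbol_dilation_le (t u : R) : 0 < t -> 0 <= u ->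
  Psi u - Psi (expR (- 2 * t) * u) <= t * (2 * (c2 * Psi u + d2)).
Proof.
move=> t0; rewrite le_eqVlt => /predU1P[<-|u0].
  by rewrite mulr0 Psi0 subrr !(mulr0, add0r) mulr_ge0 ?mulr_ge0// ltW.
have [s [s0 st]] := MVT_from0 (fun s => derive_dilated s u0) t0.
rewrite mulr0 expR0 mul1r => E.
set v := expR (- 2 * s) * u in E.
have v0 : 0 <= v by rewrite ltW// mulr_gt0 ?expR_gt0.
have Pvu : Psi v <= Psi u.
  apply: (le_trans (symbol_dilation_decay (ltW s0) (ltW u0))).
  rewrite ler_piMl ?Psi_ge0 ?ltW// -[X in _ < X]expR0 ltr_expR mulNr oppr_lt0.
  exact: mulr_gt0.
have := dPsi_le v0; have : c2 * Psi v <= c2 * Psi u by rewrite ler_wpM2l.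
move=> H1 H2; rewrite -opprB E.
rewrite -mulNr mulrC ler_pM2l//; lra.
Qed.

End dilation_of_symbol.

(** * The potential along dilations *)

Section dilation_of_potential.
Context {R : realType} (n : nat).
Implicit Types (V : 'rV[R]_n -> R) (x y : 'rV[R]_n).

Lemma dot_sqr_ge0 x : 0 <= dot x x.
Proof. by apply: sumr_ge0 => i _; rewrite -expr2 sqr_ge0. Qed.

Lemma enorm_sqr x : enorm x ^+ 2 = dot x x.
Proof. by rewrite /enorm sqr_sqrtr// dot_sqr_ge0. Qed.

Lemma weighted_mul_le (a b s : R) : 0 < s ->
  `|2 * (a * b)| <= s * (a * a) + s^-1 * (b * b).
Proof.
move=> s0; have sV : s * s^-1 = 1 by rewrite mulfV// gt_eqF.
have sV0 : 0 <= s^-1 by rewrite invr_ge0 ltW.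
have := mulr_ge0 sV0 (sqr_ge0 (s * a - b)).
have := mulr_ge0 sV0 (sqr_ge0 (s * a + b)).
have -> : s^-1 * (s * a + b) ^+ 2 =
    (s * s^-1) * (s * (a * a)) + (s * s^-1) * (2 * (a * b)) + s^-1 * (b * b) by ring.
have -> : s^-1 * (s * a - b) ^+ 2 =
    (s * s^-1) * (s * (a * a)) - (s * s^-1) * (2 * (a * b)) + s^-1 * (b * b) by ring.
rewrite sV !mul1r ler_norml; move: (s * (a * a)) (s^-1 * (b * b)) (2 * (a * b)) => A B C.
by move=> ? ?; apply/andP; split; lra.
Qed.

Lemma dot_weighted_le x y (s : R) : 0 < s ->
  `|2 * dot x y| <= s * dot x x + s^-1 * dot y y.
Proof.
move=> s0; rewrite /dot !mulr_sumr -big_split/=.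
apply: (le_trans (ler_norm_sum _ _ _)); apply: ler_sum => i _.
exact: weighted_mul_le.
Qed.

Lemma deriv_along_ray V x (r : R) : differentiable V (r *: x) ->
  is_derive r (1 : R) (fun r => V (r *: x)) (dot x (grad V (r *: x))).
Proof.
move=> dV; have dx : derivable V (r *: x) x by exact: diff_derivable.
have E : (fun h : R => h^-1 *: (V ((h *: (1 : R) + r) *: x) - V (r *: x))) =
    (fun h : R => h^-1 *: (V (h *: x + r *: x) - V (r *: x))).
  by apply/funext => h; rewrite scalerDl /GRing.scale/= mulr1.
apply: DeriveDef.
  by move: dx; rewrite /derivable /= -E.
rewrite /derive/= E -/(derive V (r *: x) x) deriveE//.
move: (r *: x) dV => y dV.
rewrite {1}(row_sum_delta x) linear_sum; apply: eq_bigr => i _.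
by rewrite linearZ /= mxE -deriveE.
Qed.

Lemma japanese_ge1 x : 1 <= japanese x.
Proof.
by rewrite /japanese -{1}(sqrtr1 R) ler_sqrt ?addr_ge0 ?sqr_ge0// lerDl sqr_ge0.
Qed.

Variables (V : 'rV[R]_n -> R) (mu c gamma : R).
Hypotheses (c_gt0 : 0 < c) (gamma_gt0 : 0 < gamma).
Hypothesis V_diff : forall x, differentiable V x.
Hypothesis dV_le : forall x, enorm (grad V x) <= c * japanese x `^ (- 1 - gamma).
Hypothesis virial : forall x, 0 <= - mu * V x - dot x (grad V x).

(** With [j = japanese x >= 1] one has [|x| <= j] and [|grad V| <= c / j]. The weight [c / j^2]
    makes both terms of [dot_weighted_le] at most [c]. *)
Lemma dot_grad_le x : `|dot x (grad V x)| <= c.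
Proof.
have j1 := japanese_ge1 x; set j := japanese x in j1.
have j0 : 0 < j by lra.
have jj : j ^+ 2 = 1 + dot x x.
  by rewrite /j /japanese sqr_sqrtr ?addr_ge0 ?sqr_ge0// enorm_sqr.
have cj : 0 < c / j ^+ 2 by rewrite divr_gt0// exprn_gt0.
have := dot_weighted_le x (grad V x) cj.
have H1 : c / j ^+ 2 * dot x x <= c.
  rewrite mulrAC ler_pdivrMr ?exprn_gt0// ler_pM2l// jj; lra.
have H2 : (c / j ^+ 2)^-1 * dot (grad V x) (grad V x) <= c.
  have : enorm (grad V x) <= c * j^-1.
    apply: (le_trans (dV_le x)); rewrite ler_pM2l// -powR_inv1; last exact: ltW.
    by apply: ler_powR => //; rewrite gerDl oppr_le0 ltW.
  rewrite -(ler_pXn2r (n := 2))// ?nnegrE ?sqrtr_ge0//; last first.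
    by rewrite mulr_ge0 ?ltW// invr_gt0.
  rewrite enorm_sqr => H; apply: (@le_trans _ _ ((c / j ^+ 2)^-1 * (c * j^-1) ^+ 2)).
    by rewrite ler_wpM2l// invr_ge0 ltW.
  have -> : (c / j ^+ 2)^-1 * (c * j^-1) ^+ 2 = c by field; rewrite !gt_eqF.
  exact: lexx.
move=> /le_trans /(_ (lerD H1 H2)); rewrite normrM (@ger0_norm _ 2)//.
by move: (`|_|) => D; lra.
Qed.

Let derive_ray x (s : R) : is_derive s (1 : R) (fun s => V (expR s *: x))
  (dot (expR s *: x) (grad V (expR s *: x))).
Proof.
have d1 := deriv_along_ray (V_diff (expR s *: x)).
have d2 : is_derive s (1 : R) expR (expR s) by exact: is_derive_expR.
rewrite dotZl mulrC.
exact: (@is_derive1_comp R (fun r => V (r *: x)) expR s _ _ d1 d2).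
Qed.

(** The hypothesis [virial] says [p' <= - mu p] for [p(s) = V(e^s x)], with the same rate as for the
    symbol. *)
Lemma potential_dilation_decay x (t : R) : 0 <= t ->
  V (expR t *: x) <= expR (- mu * t) * V x.
Proof.
move=> t0; have := @exp_decay _ _ _ mu t (derive_ray x).
rewrite expR0 scale1r; apply => // s.
by have := virial (expR s *: x); lra.
Qed.

Lemma potential_dilation_le x (t : R) : 0 < t ->
  `|V x - V (expR t *: x)| <= t * c.
Proof.
move=> t0; have [s [_ _]] := MVT_from0 (derive_ray x) t0.
rewrite expR0 scale1r distrC => ->; rewrite normrM mulrC (gtr0_norm t0) ler_pM2l//.
exact: dot_grad_le.
Qed.

End dilation_of_potential.

(** * The virial inequality *)

(* Writing z' = z + (z' - z), the integrand w z' - z w' = (m - m') z z' is at least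
   k m z^2 - t b |z' - z|. *)
Lemma commutator_lower d (T : measurableType d) (R : realType)
    (mu : {measure set T -> \bar R}) (z w z' w' b m m' : T -> R) (k t s : R) :
  0 <= t -> 0 < s -> sqint mu z -> sqint mu w -> sqint mu z' -> sqint mu w' ->
  sqint mu b ->
  {ae mu, forall x, w x = m x * z x} -> {ae mu, forall x, w' x = m' x * z' x} ->
  (forall x, k * m x <= m x - m' x) ->
  (forall x, w x = m x * z x -> `|m x - m' x| * `|z x| <= t * b x) ->
  k * ip mu w z - t / 2 *
    (s * ip mu b b + s^-1 * ip mu (fun x => z' x - z x) (fun x => z' x - z x)) <=
  ip mu w z' - ip mu z w'.
Proof.
move=> t0 s0 sz sw sz' sw' sb wE w'E km mb.
have sd := sqintB sz' sz.
have i1 := integZ k (sqintM sw sz).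
have i2 := integZ s (sqintM sb sb); have i3 := integZ s^-1 (sqintM sd sd).
have i4 := integZ (t / 2) (integD i2 i3).
rewrite /ip -!RintZ//; do ?exact: sqintM.
rewrite -RintD// -RintZ; last exact: integD.
rewrite -!RintB//; do ?exact: sqintM.
apply: ae_le_Rint.
- exact: integB.
- by apply: integB; exact: sqintM.
apply: filterS2 wE w'E => x wx w'x.
have {}mb := mb x wx.
have kz : k * (w x * z x) <= (m x - m' x) * (z x * z x).
  rewrite wx -mulrA mulrA ler_wpM2r ?km// -expr2; exact: sqr_ge0.
have E : w x * z' x - z x * w' x =
    (m x - m' x) * (z x * z x) + ((m x - m' x) * z x) * (z' x - z x).
  by rewrite wx w'x; ring.
have H1 : `|((m x - m' x) * z x) * (z' x - z x)| <= t * `|b x * (z' x - z x)|.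
  rewrite normrM (normrM (b x)) mulrA ler_wpM2r// normrM (le_trans mb)//.
  by rewrite ler_wpM2l// ler_norm.
have := weighted_mul_le (b x) (z' x - z x) s0; rewrite normrM (@ger0_norm _ 2)// => H2.
have H3 := ler_wpM2l t0 H2.
have H4 := lerNnormlW (lexx `|((m x - m' x) * z x) * (z' x - z x)|).
rewrite E; move: H1 H3 H4 kz.
set A := _ * (z x * z x); set B := _ * (z' x - z x); set Q := `|b x * _|.
set U := s * _ + _; set W := k * _.
move: (`|B|) => NB H1 H3 H4 kz.
have -> : t / 2 * U = 2^-1 * (t * U) by ring.
have := H3; rewrite mulrCA; move: (t * U) (t * Q) H1 => TU TQ H1 ?.
lra.
Qed.

Lemma sq_ipcB (R : realType) n (f g : 'rV[R]_n -> R[i]) : sqintc f -> sqintc g ->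
  ipc (fun x => f x - g x) (fun x => f x - g x) = ipc f f - 2 * ipc f g + ipc g g.
Proof. by move=> [? ?] [? ?]; rewrite /ipc reB imB !sq_ipB//; ring. Qed.

(** Continuity of the affine action with no translation, applied to both parts of [f]. The bound
    [t <= 1] is there for [one_sub_expR_ge]. *)
Lemma sqintc_dilation_cvg (R : realType) n (f : 'rV[R]_n -> R[i]) (e : R) :
  sqintc f -> 0 < e -> exists t, [/\ 0 < t, t <= 1 &
    ipc (fun x => f (affine_rV (expR t) 0 x) - f x)
        (fun x => f (affine_rV (expR t) 0 x) - f x) < e].
Proof.
move=> [s1 s2] e0; have e2 : 0 < e / 2 by rewrite divr_gt0.
have [d1 [d10 _ H1]] := sqint_affine_continuous s1 e2.
have [d2 [d20 _ H2]] := sqint_affine_continuous s2 e2.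
have : expR t @[t --> (0 : R)] --> (1 : R).
  by rewrite -[X in _ --> X]expR0; exact: continuous_expR.
move=> /cvgrPdist_lt /(_ (Num.min d1 d2)); rewrite lt_min d10 d20 => /(_ isT).
move=> /nbhs_ballP[r /= r0 Hr].
pose t := Num.min 1 (r / 2).
have t0 : 0 < t by rewrite lt_min ltr01 divr_gt0.
have tr : t < r by rewrite gt_min; apply/orP; right; rewrite ltr_pdivrMr// ltr_pMr// ltr1n.
exists t; split => //; first by rewrite ge_min lexx.
have : `|1 - expR t| < Num.min d1 d2.
  by apply: Hr; rewrite /ball/= sub0r normrN gtr0_norm.
rewrite lt_min distrC => /andP[a1 a2].
have n1 : affine_near d1 (expR t) (0 : 'rV[R]_n) by split => // i; rewrite mxE normr0.
have n2 : affine_near d2 (expR t) (0 : 'rV[R]_n) by split => // i; rewrite mxE normr0.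
rewrite /ipc reB imB; have := H1 _ _ n1; have := H2 _ _ n2; rewrite /re /im.
by move: (ip _ _ _) (ip _ _ _) => A B; lra.
Qed.

Lemma ipc_gt0 (R : realType) n (f : 'rV[R]_n -> R[i]) : sqintc f ->
  ~ {ae @lebesgue_rV R n, forall x, f x = 0} -> 0 < ipc f f.
Proof.
move=> [[m1 i1] [m2 i2]] f0; rewrite lt_neqAle eq_sym ipc_ge0 andbT.
apply/eqP => E; apply: f0.
have i12 := integD i1 i2.
have E0 : (\int[@lebesgue_rV R n]_x `|(re f x ^+ 2 + im f x ^+ 2)%:E| = 0)%E.
  transitivity (\int[@lebesgue_rV R n]_x (re f x ^+ 2 + im f x ^+ 2)%:E)%E.
    by apply: eq_integral => x _; rewrite gee0_abs// lee_fin addr_ge0 ?sqr_ge0.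
  by rewrite integ_EFin// RintD//; congr EFin; exact: E.
have := (ae_eq_integral_abs _ measurableT (measurable_int _ i12)).1 E0.
apply: filterS => x /(_ I) [] /eqP.
rewrite paddr_eq0 ?sqr_ge0// !sqrf_eq0 => /andP[/eqP rx /eqP ix].
by apply/eqP; rewrite eq_complex; apply/andP; split; apply/eqP.
Qed.

(** Factor out [e^(- nu t) >= e^(- nu)] and use [e^y - 1 >= y]. The gain [1 - e^(- mu t)] is thus at
    least linear in [t]. *)
Lemma one_sub_expR_ge (R : realType) (nu t : R) : 0 <= nu -> 0 < t -> t <= 1 ->
  nu * expR (- nu) * t <= 1 - expR (- nu * t).
Proof.
move=> nu0 t0 t1.
have -> : 1 - expR (- nu * t) = expR (- nu * t) * (expR (nu * t) - 1).
  by rewrite mulrBr -expRD mulNr addNr expR0 mulr1.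
have -> : nu * expR (- nu) * t = expR (- nu) * (nu * t) by ring.
apply: ler_pM.
- exact: expR_ge0.
- by rewrite mulr_ge0// ltW.
- by rewrite ler_expR mulNr lerN2 ler_piMr.
- by rewrite lerBrDl expR_ge1Dx.
Qed.

(** Adds the four instances of [commutator_lower]: real and imaginary parts, in frequency and in
    position. *)
Lemma sum_le4 (R : realType) (k t s r A1 A2 A3 A4 B1 B2 B3 B4 D1 D2 D3 D4
    L1 L2 L3 L4 M1 M2 M3 M4 : R) :
  k * A1 - t * (s * B1 + r * D1) <= L1 - M1 ->
  k * A2 - t * (s * B2 + r * D2) <= L2 - M2 ->
  k * A3 - t * (s * B3 + r * D3) <= L3 - M3 ->
  k * A4 - t * (s * B4 + r * D4) <= L4 - M4 ->
  k * ((A1 + A2) + (A3 + A4)) -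
    t * (s * (B1 + B2 + B3 + B4) + r * ((D1 + D2) + (D3 + D4))) <=
  ((L1 + L2) - (M1 + M2)) + ((L3 + L4) - (M3 + M4)).
Proof.
by move=> H1 H2 H3 H4; have := lerD (lerD H1 H2) (lerD H3 H4); congr (_ <= _); ring.
Qed.

(** Applied with [z = s K] and [y = D / s]: the first and third conditions give [X / 2 < z], whereas
    the second says [X / 2 = z + s]. *)
Lemma sum_small_contra (R : realFieldType) (s X z y : R) : 0 < s ->
  X <= z + (y + y) -> X = 2 * z + 2 * s -> y < X / 4 -> False.
Proof. by lra. Qed.

Lemma ipc_resolvent (R : realType) n (lambda : R) (f g h : 'rV[R]_n -> R[i]) :
  sqintc f -> sqintc g -> sqintc h ->
  ipc (fun x => lambda%:C * f x - g x) h = lambda * ipc f h - ipc g h.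
Proof.
move=> [sf1 sf2] [sg1 sg2] [sh1 sh2].
rewrite /ipc reB imB reZ imZ !(ipBl, ipZl)//; do ?exact: sqintZ.
by rewrite mulrDr opprD addrACA.
Qed.

(* [derive1] is total, so [u * derive1 Psi u] is 0 at u = 0. *)
Theorem theorem3p12 (R : realType) (d : nat) (d_gt0 : (0 < d)%N)
    (Psi : R -> R) (V : 'rV[R]_d -> R)
    (Psi_meas : measurable_fun (`[0, +oo[%classic : set R) Psi)
    (Psi_C1 : C1_pos Psi)
    (Psi_ge0 : forall u, 0 <= u -> 0 <= Psi u)
    (dPsi_ge0 : forall u, 0 < u -> 0 <= derive1 Psi u)
    (Psi_at0 : Psi u @[u --> 0^'+] --> (0 : R))
    (Psi0 : Psi 0 = 0)
    (c2 d2 : R) (c2_ge0 : 0 <= c2) (d2_ge0 : 0 <= d2)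
    (dPsi_le : forall u, 0 <= u -> u * derive1 Psi u <= c2 * Psi u + d2)
    (mu : R) (mu_gt0 : 0 < mu)
    (dPsi_ge : forall u, 0 <= u -> mu * Psi u <= 2 * u * derive1 Psi u)
    (V_C1 : C1_rV V)
    (c gamma : R) (c_gt0 : 0 < c) (gamma_gt0 : 0 < gamma)
    (V_le : forall x, `|V x| <= c * japanese x `^ (- gamma))
    (dV_le : forall x, enorm (grad V x) <= c * japanese x `^ (- 1 - gamma))
    (virial : forall x, 0 <= - mu * V x - dot x (grad V x)) :
  forall lambda : R, 0 < lambda ->
    ~ is_eigenvalue (hamiltonian Psi V) lambda%:C.
Proof.
move=> lambda lambda0 [f [g [Lf f0 [g0 [fh Ff Fg] gE] gl]]].
have Pf := fourier_L2_pair Ff; have := fourier_L2_pair Fg.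
pose u (xi : 'rV[R]_d) : R := enorm xi ^+ 2 / 2.
set eta := fun xi => _ => Pg.
have etaE xi : eta xi = (Psi (u xi))%:C * fh xi by [].
have [sf sfh _] := Pf; have [sg seta _] := Pg.
(* A representative of [V f]; in this form it is visibly in L^2, and its pairings bring in
   [lambda]. *)
pose w x := lambda%:C * f x - g0 x.
have sw : sqintc w by apply: sqintcB => //; exact: sqintcZ.
have wE : {ae @lebesgue_rV R d, forall x, w x = (V x)%:C * f x}.
  by apply: filterS2 gE gl => x gx glx; rewrite /w -glx gx addrAC subrr add0r.
have N0 := ipc_gt0 sf f0; set N := ipc f f in N0.
have [[sf1 sf2] [sfh1 sfh2]] := (sf, sfh).
have [[seta1 seta2] [sw1 sw2]] := (seta, sw).
(* L^2 majorants of the changes of [Psi(u) fh] and [V f] under dilation of the symbol or potential,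
   per unit of [t]. *)
pose b1 xi := 2 * (c2 * `|re eta xi| + d2 * `|re fh xi|).
pose b2 xi := 2 * (c2 * `|im eta xi| + d2 * `|im fh xi|).
pose b3 x := c * `|re f x|; pose b4 x := c * `|im f x|.
have sb1 : sqint (@lebesgue_rV R d) b1.
  by apply/sqintZ/sqintD; apply/sqintZ/sqint_norm.
have sb2 : sqint (@lebesgue_rV R d) b2.
  by apply/sqintZ/sqintD; apply/sqintZ/sqint_norm.
have sb3 : sqint (@lebesgue_rV R d) b3 by apply/sqintZ/sqint_norm.
have sb4 : sqint (@lebesgue_rV R d) b4 by apply/sqintZ/sqint_norm.
pose sqn b := ip (@lebesgue_rV R d) b b.
pose K := sqn b1 + sqn b2 + sqn b3 + sqn b4.
have K0 : 0 <= K by rewrite !addr_ge0// ip_ge0.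
(* The lower bound for [k * (lambda * N)] will be [t X / 2]. The weight [s], chosen so that
   [X = 2 s K + 2 s], depends on [f] but not on [t]; then [t] is taken so small that
   [D < X s / 4]. *)
pose X := 2 * (mu * expR (- mu) * (lambda * N)).
have X0 : 0 < X by rewrite !mulr_gt0 ?expR_gt0.
have K1 : 0 < 2 * (K + 1) by rewrite mulr_gt0// ltr_wpDl.
pose s := X / (2 * (K + 1)); have s0 : 0 < s by rewrite divr_gt0.
have e0 : 0 < X * s / 4 by rewrite divr_gt0// mulr_gt0.
have [t [t0 t1 Dlt]] := sqintc_dilation_cvg sf e0.
set D := ipc _ _ in Dlt; set a := expR t in D Dlt.
have a0 : 0 < a by exact: expR_gt0.
have an0 : a != 0 by rewrite gt_eqF.
pose fa x := f (affine_rV a 0 x); pose ga x := g0 (affine_rV a 0 x).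
pose wa x := w (affine_rV a 0 x).
have := fourier_pair_dilation a0 Pf; rewrite -/fa.
set ha := fun xi => _ => Pfa.
have := fourier_pair_dilation a0 Pg; rewrite -/ga.
set ka := fun xi => _ => Pga.
have [sfa sha _] := Pfa; have [sga ska _] := Pga.
have swa : sqintc wa by exact: sqintc_affine.
have waE : {ae @lebesgue_rV R d, forall x, wa x = (V (a *: x))%:C * fa x}.
  have := ae_affine 0 an0 wE; apply: filterS => x.
  by rewrite /wa /fa /affine_rV addr0.
have u0 xi : 0 <= u xi by rewrite divr_ge0// sqr_ge0.
(* The transform of the dilated [g0] is [Psi] at the frequency [xi / a], times [ha]; hence the
   symbol is evaluated at [e^(-2t) u]. *)
pose u' xi := expR (- 2 * t) * u xi.
have u'E xi : u (affine_rV a^-1 0 xi) = u' xi.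
  rewrite /u'.
  have <- : a^-1 * a^-1 = expR (- 2 * t).
    by rewrite /a -expRN -expRD; congr expR; ring.
  by rewrite /u /affine_rV addr0 !enorm_sqr dotZl dotZr !mulrA.
have kaE xi : ka xi = (Psi (u' xi))%:C * ha xi.
  by rewrite /ka /ha etaE u'E mulrCA.
pose k := 1 - expR (- mu * t).
have kPsi xi : k * Psi (u xi) <= Psi (u xi) - Psi (u' xi).
  have := symbol_dilation_decay Psi_C1 Psi0 dPsi_ge (ltW t0) (u0 xi).
  by rewrite -/(u' xi) /k; lra.
have kV x : k * V x <= V x - V (a *: x).
  have := potential_dilation_decay V_C1.1 virial x (ltW t0).
  by rewrite /k /a; lra.
(* The bound [c2 Psi(u) + d2] times [|z|] is rewritten with [y = Psi(u) z], so that it involves only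
   functions in L^2. *)
have bPsi xi (z y : R) : y = Psi (u xi) * z ->
    `|Psi (u xi) - Psi (u' xi)| * `|z| <= t * (2 * (c2 * `|y| + d2 * `|z|)).
  move=> ->; have P0 := Psi_ge0 _ (u0 xi).
  have k0 : 0 <= k.
    rewrite subr_ge0 -[X in _ <= X]expR0 ler_expR mulNr oppr_le0.
    by rewrite mulr_ge0 ?(ltW mu_gt0) ?(ltW t0).
  rewrite ger0_norm; last by apply: le_trans (kPsi xi); exact: mulr_ge0.
  rewrite normrM (ger0_norm P0).
  have := symbol_dilation_le Psi_C1 Psi_ge0 Psi0 c2_ge0 d2_ge0 mu_gt0
    dPsi_le dPsi_ge t0 (u0 xi).
  move=> /(ler_wpM2r (normr_ge0 z)) /le_trans; apply.
  by rewrite le_eqVlt; apply/orP; left; apply/eqP; ring.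
have bV x (z : R) : `|V x - V (a *: x)| * `|z| <= t * (c * `|z|).
  have VV : `|V x - V (a *: x)| <= t * c.
    exact: (potential_dilation_le c_gt0 gamma_gt0 V_C1.1 dV_le x t0).
  by rewrite mulrA; apply: ler_wpM2r.
have [[sfa1 sfa2] [sha1 sha2]] := (sfa, sha).
have [[ska1 ska2] [swa1 swa2]] := (ska, swa).
have reeta : {ae @lebesgue_rV R d, forall x, re eta x = (Psi \o u) x * re fh x}.
  by apply: nearW => x; exact: ReZ.
have reka : {ae @lebesgue_rV R d, forall x, re ka x = (Psi \o u') x * re ha x}.
  by apply: nearW => x; rewrite /re kaE ReZ.
have rew : {ae @lebesgue_rV R d, forall x, re w x = V x * re f x}.
  by apply: filterS wE => x; rewrite /re => ->; exact: ReZ.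
have rewa : {ae @lebesgue_rV R d, forall x, re wa x = V (a *: x) * re fa x}.
  by apply: filterS waE => x; rewrite /re => ->; exact: ReZ.
have imeta : {ae @lebesgue_rV R d, forall x, im eta x = (Psi \o u) x * im fh x}.
  by apply: nearW => x; exact: ImZ.
have imka : {ae @lebesgue_rV R d, forall x, im ka x = (Psi \o u') x * im ha x}.
  by apply: nearW => x; rewrite /im kaE ImZ.
have imw : {ae @lebesgue_rV R d, forall x, im w x = V x * im f x}.
  by apply: filterS wE => x; rewrite /im => ->; exact: ImZ.
have imwa : {ae @lebesgue_rV R d, forall x, im wa x = V (a *: x) * im fa x}.
  by apply: filterS waE => x; rewrite /im => ->; exact: ImZ.
have C1 := commutator_lower (ltW t0) s0 sfh1 seta1 sha1 ska1 sb1 reeta reka kPsi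
  (fun x => bPsi x _ _).
have C2 := commutator_lower (ltW t0) s0 sfh2 seta2 sha2 ska2 sb2 imeta imka kPsi
  (fun x => bPsi x _ _).
have C3 := commutator_lower (ltW t0) s0 sf1 sw1 sfa1 swa1 sb3 rew rewa kV
  (fun x _ => bV x _).
have C4 := commutator_lower (ltW t0) s0 sf2 sw2 sfa2 swa2 sb4 imw imwa kV
  (fun x _ => bV x _).
(* The kinetic pairings are moved back to position space, where they meet those coming from [w] and
   [wa]. *)
have E1 := parseval Pg Pfa; have E2 := parseval Pf Pga; have E3 := parseval Pg Pf.
have ED : ipc (fun x => ha x - fh x) (fun x => ha x - fh x) = D.
  rewrite /D -/fa !sq_ipcB//.
  by rewrite (parseval Pfa Pfa) (parseval Pfa Pf) (parseval Pf Pf).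
have E5 : ipc w f = lambda * N - ipc g0 f by exact: ipc_resolvent.
have E6 : ipc w fa = lambda * ipc f fa - ipc g0 fa by exact: ipc_resolvent.
have E7 : ipc f wa = lambda * ipc f fa - ipc f ga.
  rewrite ipcC (ipcC f fa) (ipcC f ga); exact: (ipc_resolvent _ sfa sga sf).
have kt := one_sub_expR_ge (ltW mu_gt0) t0 t1; rewrite -/k in kt.
have sum : k * (ipc eta fh + ipc w f) - t / 2 * (s * K + s^-1 *
    (ipc (fun x => ha x - fh x) (fun x => ha x - fh x) + D)) <=
    (ipc eta ha - ipc fh ka) + (ipc w fa - ipc f wa).
  have ipcB (h1 h2 : 'rV[R]_d -> R[i]) :
      ipc (fun x => h1 x - h2 x) (fun x => h1 x - h2 x) =
      ip (@lebesgue_rV R d) (fun x => re h1 x - re h2 x) (fun x => re h1 x - re h2 x) +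
      ip (@lebesgue_rV R d) (fun x => im h1 x - im h2 x) (fun x => im h1 x - im h2 x).
    by rewrite /ipc reB imB.
  rewrite /D !ipcB; exact: (sum_le4 C1 C2 C3 C4).
(* The eigenvalue equation enters: on the right every pairing with [g0], [ga] and every
   [lambda <f, fa>] cancels, and on the left only [lambda N] remains. *)
have H : k * (lambda * N) <= t / 2 * (s * K + s^-1 * (D + D)).
  move: sum; rewrite ED -E1 -E2 -E3 E5 E6 E7.
  move: (ipc g0 f) (ipc g0 fa) (ipc f fa) (ipc f ga) (lambda * N) => x1 x2 x3 x4 x5.
  move: (t / 2 * _) => y.
  have -> : x1 + (x5 - x1) = x5 by ring.
  have -> : x2 - x4 + (lambda * x3 - x2 - (lambda * x3 - x4)) = 0 by ring.
  by rewrite subr_le0.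
have lN : 0 < lambda * N by exact: mulr_gt0.
have XH : X <= s * K + s^-1 * (D + D).
  rewrite -(ler_pM2l t0); have := ler_wpM2r (ltW lN) kt.
  have -> : mu * expR (- mu) * t * (lambda * N) = t * X / 2.
    by rewrite /X; field.
  move=> /le_trans /(_ H); move: (s * K + _) => y.
  have -> : t / 2 * y = t * y / 2 by ring.
  by rewrite ler_pM2r.
have sK : X = 2 * (s * K) + 2 * s.
  have <- : s * (2 * (K + 1)) = X by rewrite /s divfK ?gt_eqF.
  by ring.
have sD : s^-1 * D < X / 4.
  rewrite -(ltr_pM2l s0) mulrA mulfV ?gt_eqF// mul1r.
  by have -> : s * (X / 4) = X * s / 4 by ring.
by apply: (sum_small_contra s0 _ sK sD); rewrite -mulrDr.
Qed.
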